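(* Let $\alpha\ge 2$ be a real number and let $\Omega\subset\mathbb R^N$ be a bounded $C^1$ domain. Define $u:\mathbb R^N\to\mathbb R$ by $$u(x)=\begin{cases}\displaystyle\int_\Omega \log\frac{1}{|x-y|}\,dy, & N=\alpha,\\[2mm] \displaystyle\int_\Omega \frac{1}{|x-y|^{N-\alpha}}\,dy, & N\neq\alpha.\end{cases}$$ If $u$ is constant on $\partial\Omega$, then $\Omega$ is a ball.
   Context: A domain is a nonempty connected open set. *)

(* Defs.v *)
From HB Require Import structures.
From mathcomp Require Import all_boot all_order all_algebra.
From mathcomp Require Import all_classical all_reals all_analysis.
Set Implicit Arguments.
Unset Strict Implicit.
Unset Printing Implicit Defensive.
Import Order.TTheory GRing.Theory Num.Theory numFieldNormedType.Exports.
Local Open Scope classical_set_scope.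
Local Open Scope ring_scope.

(* The library has no measurable structure on matrices.  The sigma-algebra
   below is the product one, generated by the coordinates; it coincides with the
   Borel sigma-algebra of the topology of 'M[R]_(m, n). *)
Definition mx_cylinder (R : realType) (m n : nat) : set (set 'M[R]_(m, n)) :=
  [set A | exists i j, exists2 B : set (measurableTypeR R),
     measurable B & A = [set M : 'M[R]_(m, n) | B (M i j)]].

Fact mx_display : measure_display.
Proof. exact: default_measure_display. Qed.

Section measurable_mx.
Variables (R : realType) (m n : nat).

Let mx_set0 : <<s @mx_cylinder R m n >> set0.
Proof. exact: sigma_algebra0. Qed.

Let mx_setC A : <<s @mx_cylinder R m n >> A -> <<s @mx_cylinder R m n >> (~` A).
Proof. exact: sigma_algebraC. Qed.

Let mx_bigcup (F : (set 'M[R]_(m, n))^nat) :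
  (forall i, <<s @mx_cylinder R m n >> (F i)) ->
  <<s @mx_cylinder R m n >> (\bigcup_i (F i)).
Proof. exact: sigma_algebra_bigcup. Qed.

HB.instance Definition _ := @isMeasurable.Build mx_display 'M[R]_(m, n)
  <<s @mx_cylinder R m n >> mx_set0 mx_setC mx_bigcup.
End measurable_mx.

Definition rV_cons (R : realType) (n : nat)
    (p : measurableTypeR R * 'rV[R]_n) : 'rV[R]_n.+1 :=
  row_mx (const_mx p.1 : 'rV[R]_1) p.2.

(* n-fold product of the one-dimensional Lebesgue measure. *)
Fixpoint lebesgue_rV (R : realType) (n : nat) : set 'rV[R]_n -> \bar R :=
  match n return set 'rV[R]_n -> \bar R with
  | 0%N => dirac (0 : 'rV[R]_0)
  | n'.+1 =>
      pushforward (lebesgue_measure \x @lebesgue_rV R n')%E (@rV_cons R n')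
  end.
Arguments lebesgue_rV : clear implicits.

Section bundle_sigma_finite.
Context d (T : measurableType d) (R : realType).
Variable mu : {measure set T -> \bar R}.
Hypothesis mu_fin : sigma_finite setT mu.

Let nu : set T -> \bar R := mu.
HB.instance Definition _ := Measure.on nu.
HB.instance Definition _ := Measure_isSigmaFinite.Build _ _ _ nu mu_fin.

Lemma bundle_sigma_finite :
  exists m : {sigma_finite_measure set T -> \bar R}, mu = m :> (set T -> \bar R).
Proof. by exists nu. Qed.
End bundle_sigma_finite.

Section lebesgue_rV_measure.
Variable R : realType.

Lemma measurable_coord m n (i : 'I_m) (j : 'I_n) :
  measurable_fun setT (fun M : 'M[R]_(m, n) => M i j : measurableTypeR R).
Proof.
by move=> _ B mB; rewrite setTI; apply: sub_sigma_algebra; exists i, j, B.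
Qed.

Lemma measurable_fun_mx d (T : measurableType d) m n (f : T -> 'M[R]_(m, n)) :
  (forall i j, measurable_fun setT (fun x => f x i j : measurableTypeR R)) ->
  measurable_fun setT f.
Proof.
move=> mf; apply: (@measurability _ _ _ _ _ _ (@mx_cylinder R m n)) => //.
by move=> _ [_ [i [j [B mB ->]]] <-]; exact: (mf i j measurableT B mB).
Qed.

Lemma measurable_rV_cons n : measurable_fun setT (@rV_cons R n).
Proof.
apply: measurable_fun_mx => i j; rewrite /rV_cons.
case: (@split_ordP 1 n j) => k ->.
  rewrite [X in measurable_fun _ X](_ : _ = fst) //.
  by apply/funext => p; rewrite (@row_mxEl _ 1 1 n) mxE.
rewrite [X in measurable_fun _ X](_ : _ = (fun M : 'rV[R]_n => M i k) \o snd).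
  apply: measurableT_comp; [exact: measurable_coord|exact: measurable_snd].
by apply/funext => p; rewrite (@row_mxEr _ 1 1 n).
Qed.

Let rV_uncons n (v : 'rV[R]_n.+1) : measurableTypeR R * 'rV[R]_n :=
  (v ord0 ord0, @rsubmx _ 1 1 n v).

Let rV_consK n : cancel (@rV_cons R n) (@rV_uncons n).
Proof.
move=> [x v]; rewrite /rV_uncons /rV_cons /= row_mxKr; congr pair.
rewrite (_ : ord0 = lshift n (ord0 : 'I_1)); last exact/val_inj.
by rewrite (@row_mxEl _ 1 1 n) mxE.
Qed.

Let rV_unconsK n : cancel (@rV_uncons n) (@rV_cons R n).
Proof.
move=> v; rewrite /rV_cons /= -[RHS](@hsubmxK _ 1 1 n).
apply: (congr1 (fun A => @row_mx _ 1 1 n A _)).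
by apply/matrixP => i j; rewrite !mxE !ord1; congr (v _ _); apply/val_inj.
Qed.

Let measurable_rV_uncons n : measurable_fun setT (@rV_uncons n).
Proof.
apply/measurable_fun_pairP; split; first exact: measurable_coord.
apply: measurable_fun_mx => i j.
rewrite [X in measurable_fun _ X](_ : _ =
  fun M : 'rV[R]_n.+1 => M i (rshift 1 j)); first exact: measurable_coord.
by apply/funext => v; rewrite /= mxE.
Qed.

Let lebesgue_rVP n :
  exists mu : {sigma_finite_measure set 'rV[R]_n -> \bar R},
    lebesgue_rV R n = mu.
Proof.
elim: n => [|n [mu IH]]; first by eexists.
rewrite /= IH.
have [nu nuE] : exists nu : {measure set 'rV[R]_n.+1 -> \bar R},
    pushforward (lebesgue_measure \x mu)%E (@rV_cons R n) = nu.
  unshelve (eexists (pushforward (lebesgue_measure \x mu)%E (@rV_cons R n) :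
    {measure set 'rV[R]_n.+1 -> \bar R}); reflexivity).
  exact: measurable_rV_cons.
have nu_fin : sigma_finite setT nu.
  have /sigma_finiteP[F [TF ndF Foo]] := sigma_finiteT (@lebesgue_measure R).
  have /sigma_finiteP[G [TG ndG Goo]] := sigma_finiteT mu.
  exists (fun k => @rV_uncons n @^-1` (F k `*` G k)) => [|k].
    rewrite -preimage_bigcup -[LHS](preimage_setT (@rV_uncons n)).
    congr (_ @^-1` _); rewrite -setXTT TF TG.
    apply/seteqP; split => -[x v] /=; last by move=> [k _ [? ?]]; split; exists k.
    move=> [[k _ Fkx] [l _ Glv]]; exists (maxn k l) => //; split.
      by move: x Fkx; exact/subsetPset/ndF/leq_maxl.
    by move: v Glv; exact/subsetPset/ndG/leq_maxr.
  have [mF oF] := Foo k; have [mG oG] := Goo k; split.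
    rewrite -[X in measurable X]setTI.
    by apply: measurable_rV_uncons => //; exact: measurableX.
  rewrite -nuE /pushforward -comp_preimage (_ : _ \o _ = id); last first.
    by apply/funext => p /=; rewrite rV_consK.
  by rewrite preimage_id product_measure1E// lte_mul_pinfty// ge0_fin_numE.
by have [mu' mu'E] := bundle_sigma_finite nu_fin; exists mu'; rewrite nuE.
Qed.

Let lebesgue_rV0 n : lebesgue_rV R n set0 = 0%E.
Proof. by have [mu ->] := lebesgue_rVP n. Qed.

Let lebesgue_rV_ge0 n A : (0 <= lebesgue_rV R n A)%E.
Proof. by have [mu ->] := lebesgue_rVP n. Qed.

Let lebesgue_rV_semi_sigma_additive n :
  semi_sigma_additive (lebesgue_rV R n).
Proof.
by have [mu ->] := lebesgue_rVP n; exact: measure_semi_sigma_additive.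
Qed.

Let lebesgue_rV_sigma_finite n : sigma_finite setT (lebesgue_rV R n).
Proof. by have [mu ->] := lebesgue_rVP n; exact: sigma_finiteT. Qed.

HB.instance Definition _ n := isMeasure.Build _ _ _ (lebesgue_rV R n)
  (@lebesgue_rV0 n) (@lebesgue_rV_ge0 n) (@lebesgue_rV_semi_sigma_additive n).

HB.instance Definition _ n := Measure_isSigmaFinite.Build _ _ _
  (lebesgue_rV R n) (@lebesgue_rV_sigma_finite n).

Lemma lebesgue_rV_box n (B : 'I_n -> set (measurableTypeR R)) :
  (forall i, measurable (B i)) ->
  lebesgue_rV R n [set v | forall i, B i (v ord0 i)] =
  (\prod_(i < n) lebesgue_measure (B i))%E.
Proof.
elim: n B => [|n IH] B mB.
  rewrite big_ord0 /= diracE mem_set //=.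
  by move=> i; case: i.
have mS : measurable [set v : 'rV[R]_n | forall i, B (lift ord0 i) (v ord0 i)].
  rewrite [X in measurable X](_ : _ = \bigcap_(i in [set: 'I_n])
    (fun v : 'rV[R]_n => v ord0 i) @^-1` B (lift ord0 i)).
    apply: fin_bigcap_measurable => [|i _]; first exact: finite_finset.
    by rewrite -[X in measurable X]setTI; exact: measurable_coord.
  by apply/seteqP; split => v /= Bv i; [move=> _; exact: Bv|exact: (Bv i I)].
rewrite big_ord_recl -IH; last by move=> i; exact: mB.
rewrite -product_measure1E //=.
rewrite /pushforward; congr (product_measure1 _ _ _).
apply/seteqP; split => -[x v] /=.
  move=> Bv; split => [|i].
    have := Bv ord0; rewrite /rV_cons [X in B _ X](_ : _ = x)//.
    rewrite (_ : ord0 = lshift n (ord0 : 'I_1)); last exact/val_inj.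
    by rewrite (@row_mxEl _ 1 1 n) mxE.
  have := Bv (lift ord0 i); rewrite /rV_cons [X in B _ X](_ : _ = v ord0 i)//.
  rewrite (_ : lift ord0 i = rshift 1 i); last exact/val_inj.
  by rewrite (@row_mxEr _ 1 1 n).
move=> [Bx Bv] j; case: (@split_ordP 1 n j) => k ->; rewrite /rV_cons.
  rewrite (@row_mxEl _ 1 1 n) mxE (_ : lshift n k = ord0) //.
  by rewrite ord1; exact/val_inj.
rewrite (@row_mxEr _ 1 1 n) (_ : rshift 1 k = lift ord0 k) //.
exact/val_inj.
Qed.

End lebesgue_rV_measure.

Definition euclid_norm (R : realType) (n : nat) (x : 'rV[R]_n) : R :=
  Num.sqrt (\sum_(i < n) x ord0 i ^+ 2).

Definition euclid_ball (R : realType) (n : nat) (c : 'rV[R]_n) (r : R) :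
    set 'rV[R]_n :=
  [set x | euclid_norm (x - c) < r].

Definition boundary (T : topologicalType) (A : set T) : set T :=
  closure A `\` interior A.

Definition domain (T : topologicalType) (A : set T) : Prop :=
  [/\ A !=set0, connected A & open A].

Definition C1 (R : realType) (n : nat) (f : 'rV[R]_n -> R) : Prop :=
  (forall x, differentiable f x) /\
  (forall v : 'rV[R]_n, continuous (fun x => 'D_v f x)).

(* Near each boundary point, in suitable Cartesian coordinates y = x *m Q,
   Omega is the region y_N > g (y_1, ..., y_(N-1)) above a C^1 graph. *)
Definition C1_boundary (R : realType) (n : nat) (Omega : set 'rV[R]_n.+1) :
    Prop :=
  forall p, boundary Omega p ->
  exists (Q : 'M[R]_n.+1) (g : 'rV[R]_n -> R) (r : R),
    [/\ Q *m Q^T = 1%:M, C1 g, 0 < r &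
      forall x, euclid_ball p r x ->
        (Omega x <-> g (col' ord_max (x *m Q)) < (x *m Q) ord0 ord_max)].

Definition potential (R : realType) (N : nat) (alpha : R)
    (Omega : set 'rV[R]_N) (x : 'rV[R]_N) : R :=
  if N%:R == alpha
  then \int[lebesgue_rV R N]_(y in Omega) ln (1 / euclid_norm (x - y))
  else \int[lebesgue_rV R N]_(y in Omega)
         (1 / (euclid_norm (x - y) `^ (N%:R - alpha))).

(* Main.v *)
Require Import Defs.
From mathcomp Require Import all_boot all_order all_algebra.
From mathcomp Require Import all_classical all_reals all_analysis.
From mathcomp Require Import measurable_realfun ring lra.
Import Order.TTheory GRing.Theory Num.Theory numFieldNormedType.Exports.
Set Implicit Arguments.
Unset Strict Implicit.
Unset Printing Implicit Defensive.
Local Open Scope classical_set_scope.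
Local Open Scope ring_scope.

(** The proof is the method of moving planes in integral form. Let N be the
    dimension. Up to a nonzero factor the potential of Omega at a boundary point x
    is the integral over y in Omega of k (|x - y|^2), where k is a smooth strictly
    increasing function of the squared distance ([potentialE], [box_cox]).

    Fix a unit vector e and a level m, and write x' for the mirror image of x in
    the hyperplane x.e = m. Let p and p' be two boundary points that are mirror
    images of each other. The potential takes the same value there, so the
    function y |-> k (|p - y|^2) - k (|p' - y|^2) has integral 0 over Omega. It is
    odd under the reflection and has a strict sign on each side of the hyperplane.
    If Omega contains the mirror image of its cap above level m, the integral
    reduces to the points of Omega below the hyperplane whose mirror image is not
    in Omega; unless Omega is symmetric, these contain an open set and the integral
    cannot vanish ([integral_kernel_diff_neq0]). The boundary chart is used only to
    know that the complement of Omega is the closure of its exterior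
    ([C1_boundary_regular]), which turns points whose mirror image is outside
    Omega into open sets of such points.

    Now lower the hyperplane from infinity to the infimum l0 of the levels above
    which all caps reflect into Omega. Just below l0 some cap fails to, and leaving
    Omega along a line parallel to e yields boundary points p_j, p_j' that are
    mirror images at levels m_j tending to l0 ([critical_pair]). A limit p, p' is
    a pair of mirror images at level l0, but it may be a single point. For this
    reason the difference above is divided by the distance of p and p'
    ([kernel_diff]): the quotient is a divided difference of k, which is still
    defined, odd and of strict sign when p = p'. Since alpha >= 2, the quotients
    are bounded by multiples of |p_j - y|^(1-N) + |p_j' - y|^(1-N). These bounds are
    uniformly integrable ([excess_dominated_small]), and Vitali's theorem gives that
    the limit quotient has integral 0 as well ([integral_kernel_diff_lim]). So the
    argument for pairs of distinct points also covers tangential contact and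
    contact on the hyperplane, and Omega is symmetric ([symmetric_direction]).

    Finally, a bounded open set with this symmetry in every direction e, which
    moreover contains the segments joining its points to their mirror images, is a
    ball ([ball_of_symmetric]). *)

(** * Lebesgue measure on row vectors *)

Lemma measurable_preimageT d d' (T : measurableType d) (T' : measurableType d')
    (f : T -> T') B :
  measurable_fun setT f -> measurable B -> measurable (f @^-1` B).
Proof. by move=> mf mB; rewrite -[X in measurable X]setTI; exact: mf. Qed.

Section lebesgue_rV_theory.
Variable R : realType.

Definition rV_box n (B : 'I_n -> set (measurableTypeR R)) : set 'rV[R]_n :=
  [set v | forall i, B i (v ord0 i)].

Lemma measurable_rV_box n (B : 'I_n -> set (measurableTypeR R)) :
  (forall i, measurable (B i)) -> measurable (rV_box B).
Proof.
move=> mB; rewrite [X in measurable X](_ : _ = \bigcap_(i in [set: 'I_n])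
    (fun v : 'rV[R]_n => v ord0 i) @^-1` B i).
  apply: fin_bigcap_measurable => [|i _]; first exact: finite_finset.
  by rewrite -[X in measurable X]setTI; exact: measurable_coord.
by apply/seteqP; split => v /= Bv i; [move=> _; exact: Bv|exact: (Bv i I)].
Qed.

Lemma ball_rV_box n (c : 'rV[R]_n) e : 0 < e ->
  ball c e = rV_box (fun i => ball (c ord0 i) e).
Proof.
move=> e0; apply/seteqP; split => [v [_ +] i|v vB]; first by apply.
by split => // i j; rewrite (ord1 i); exact: vB.
Qed.

Lemma measurable_rV_ball n (c : 'rV[R]_n) e : 0 < e -> measurable (ball c e).
Proof.
by move=> e0; rewrite ball_rV_box//; apply: measurable_rV_box => i; exact: measurable_ball.
Qed.

Lemma lebesgue_rV_ball n (c : 'rV[R]_n) e : 0 < e ->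
  lebesgue_rV R n (ball c e) = ((e *+ 2) ^+ n)%:E.
Proof.
move=> e0; rewrite ball_rV_box// lebesgue_rV_box; last by move=> i; exact: measurable_ball.
under eq_bigr do rewrite lebesgue_measure_ball ?ltW//.
by rewrite prodEFin prodr_const card_ord.
Qed.

(** The sigma-algebra is generated by the coordinates, not by the topology: an
    open set is measurable because it is a countable union of rational cubes. *)
Lemma measurable_rV_open n (U : set 'rV[R]_n) : open U -> measurable U.
Proof.
move=> oU.
pose F (p : 'rV[rat]_n * nat) : set 'rV[R]_n :=
  if pselect (ball (map_mx ratr p.1 : 'rV[R]_n) (p.2.+1%:R^-1) `<=` U)
  then ball (map_mx ratr p.1 : 'rV[R]_n) (p.2.+1%:R^-1) else set0.
rewrite (_ : U = \bigcup_p F p).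
  apply: countable_bigcupT_measurable; first exact: countableP.
  move=> p; rewrite /F; case: pselect => h; last exact: measurable0.
  by apply: measurable_rV_ball; rewrite invr_gt0 ltr0n.
apply/seteqP; split => [x Ux|x [p _]]; last first.
  by rewrite /F; case: pselect => // h /h.
have /nbhs_ballP[e/= e0 eU] : nbhs x U by exact: open_nbhs_nbhs.
have [k ke] : exists k, k.+1%:R^-1 *+ 2 < e.
  have e20 : 0 < e / 2 by lra.
  have /cvgr_lt := @cvg_harmonic R.
  move=> /(_ _ e20)[k _ /(_ k (leqnn k))] /= h; exists k.
  move: h; rewrite /harmonic; move: (k.+1%:R^-1 : R) => t.
  lra.
have /choice[q qx] : forall i, exists q : rat, ball (x ord0 i) (k.+1%:R^-1) (ratr q).
  move=> i; have [|q] := @rat_in_itvoo R (x ord0 i - k.+1%:R^-1) (x ord0 i + k.+1%:R^-1).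
    by rewrite ltrBlDr -addrA ltrDl addr_gt0// invr_gt0 ltr0n.
  by rewrite in_itv/= => qx; exists q; rewrite /ball/= distrC ltr_distl.
have k0 : 0 < k.+1%:R^-1 :> R by rewrite invr_gt0 ltr0n.
exists (\row_i q i, k) => //; rewrite /F.
have xq : ball x (k.+1%:R^-1) (map_mx ratr (\row_i q i)).
  by split => // i j; rewrite !mxE (ord1 i); exact: qx.
case: pselect => /= [_|]; first exact: ball_sym.
case => z qz; apply: eU; apply: le_ball (ltW ke) _ _.
by rewrite mulr2n; exact: ball_triangle qz.
Qed.

(** Boxes with measurable sides generate the sigma-algebra and are stable under
    intersection, so a measure finite on large cubes is determined by them. *)
Lemma lebesgue_rV_unique n (mu : {measure set 'rV[R]_n -> \bar R}) :
  (forall B, (forall i, measurable (B i)) ->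
    lebesgue_rV R n (rV_box B) = mu (rV_box B)) ->
  forall A, measurable A -> lebesgue_rV R n A = mu A.
Proof.
move=> muE.
pose G : set (set 'rV[R]_n) :=
  [set A | exists2 B, (forall i, measurable (B i)) & A = rV_box B].
pose g k : set 'rV[R]_n := rV_box (fun i => ball (0 : R) k.+1%:R).
apply: (measure_unique G g) => //.
- apply/seteqP; split; last first.
    apply: smallest_sub; first exact: sigma_algebra_measurable.
    by move=> _ [B mB ->]; exact: measurable_rV_box.
  apply: smallest_sub; first exact: smallest_sigma_algebra.
  move=> _ [i [j [B mB ->]]]; apply: sub_sigma_algebra.
  exists (fun k => if k == j then B else setT).
    by move=> k; case: ifP.
  apply/seteqP; split => v /=.
    by rewrite (ord1 i) => Bv k; case: eqP => // ->.
  by rewrite (ord1 i) => /(_ j); rewrite eqxx.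
- move=> _ _ [B mB ->] [C mC ->]; exists (fun i => B i `&` C i).
    by move=> i; exact: measurableI.
  apply/seteqP; split => v /= => [[Bv Cv] i|BC]; first by split.
  by split => i; have [] := BC i.
- by move=> k; exists (fun=> ball (0 : R) k.+1%:R) => // i; exact: measurable_ball.
- apply/seteqP; split => // v _; exists (Num.truncn `|v|) => //= i.
  have : ball (0 : 'rV[R]_n) (Num.truncn `|v|).+1%:R v.
    by rewrite -ball_normE/= sub0r normrN truncnS_gt.
  by case=> _ /(_ ord0 i); rewrite mxE.
- by move=> _ [B mB ->]; exact: muE.
- move=> k; rewrite /g (_ : rV_box _ = ball (0 : 'rV[R]_n) k.+1%:R).
    by rewrite [ltLHS](lebesgue_rV_ball (0 : 'rV[R]_n) (ltr0Sn R k)) ltry.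
  rewrite ball_rV_box//; congr (rV_box _); apply/funext => i; by rewrite mxE.
Qed.

Lemma lebesgue_measureD (a : R) (A : set (measurableTypeR R)) :
  measurable A -> lebesgue_measure [set x | A (x + a)] = lebesgue_measure A.
Proof.
move=> mA.
have ma : measurable_fun setT (fun x : measurableTypeR R => x + a : measurableTypeR R).
  exact: measurable_funD.
pose nu := pushforward (@lebesgue_measure R)
  (fun x : measurableTypeR R => x + a : measurableTypeR R).
have [nu' nuE] : exists nu' : {measure set (measurableTypeR R) -> \bar R}, nu = nu' :> (set _ -> _).
  by unshelve (eexists (nu : {measure set _ -> \bar R}); reflexivity).
apply/esym; rewrite (@lebesgue_measure_unique _ nu')//; first by rewrite -nuE.
move=> _ [[b c]] _ <-; rewrite -nuE /nu /pushforward/=.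
rewrite (_ : _ @^-1` _ = `]b - a, c - a]%classic).
  rewrite !lebesgue_measure_itv/= !lte_fin ltrD2r; case: ifP => // _.
  by congr EFin; rewrite opprB addrA subrK.
by apply/seteqP; split => x /=; rewrite !in_itv/= ltrBlDr lerBrDr.
Qed.

Lemma measurable_rVD n : measurable_fun setT (fun p : 'rV[R]_n * 'rV[R]_n => p.1 + p.2).
Proof.
apply: measurable_fun_mx => i j.
under eq_fun do rewrite mxE.
by apply: measurable_funD; apply: (measurableT_comp (measurable_coord _ _)).
Qed.

Lemma measurable_rVN n : measurable_fun setT (fun p : 'rV[R]_n => - p).
Proof.
apply: measurable_fun_mx => i j.
under eq_fun do rewrite mxE.
by apply: measurableT_comp => //; exact: measurable_coord.
Qed.

Lemma measurable_rV_shift n (v : 'rV[R]_n) : measurable_fun setT (fun x : 'rV[R]_n => x + v).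
Proof.
apply: measurable_fun_mx => i j; under eq_fun do rewrite mxE.
by apply: measurable_funD => //; exact: measurable_coord.
Qed.

Lemma lebesgue_rVD n (v : 'rV[R]_n) (A : set 'rV[R]_n) :
  measurable A -> lebesgue_rV R n [set x | A (x + v)] = lebesgue_rV R n A.
Proof.
move=> mA.
pose nu := pushforward (lebesgue_rV R n) (fun x : 'rV[R]_n => x + v).
have [nu' nuE] : exists nu' : {measure set 'rV[R]_n -> \bar R}, nu = nu' :> (set _ -> _).
  unshelve (eexists (nu : {measure set _ -> \bar R}); reflexivity).
  exact: measurable_rV_shift.
apply/esym; rewrite (@lebesgue_rV_unique _ nu')//; first by rewrite -nuE.
move=> B mB; rewrite -nuE /nu /pushforward.
rewrite (_ : _ @^-1` _ = rV_box (fun i => [set x | B i (x + v ord0 i)])); last first.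
  by apply/seteqP; split => x /= + i => /(_ i) /=; rewrite mxE.
have mD i : measurable [set x : measurableTypeR R | B i (x + v ord0 i)].
  rewrite -[X in measurable X]setTI.
  have : measurable_fun setT (fun x : measurableTypeR R => x + v ord0 i : measurableTypeR R).
    exact: measurable_funD.
  by apply.
rewrite !lebesgue_rV_box//.
by apply: eq_bigr => i _; rewrite lebesgue_measureD.
Qed.

End lebesgue_rV_theory.

(** * Reflections in hyperplanes *)

Lemma continuous_sum (R : realType) (T : topologicalType) m (F : 'I_m -> T -> R) :
  (forall i, continuous (F i)) -> continuous (fun t => \sum_(i < m) F i t).
Proof.
move=> cF; elim: m F cF => [|m IH] F cF.
  by under eq_fun do rewrite big_ord0; exact: cst_continuous.
under eq_fun do rewrite big_ord_recl.
by move=> t; exact: (cvgD (cF ord0 t) (IH _ (fun i => cF (lift ord0 i)) t)).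
Qed.

Section dot_product.
Variables (R : realType) (n : nat).
Implicit Types (x y z e : 'rV[R]_n) (a m : R).

Definition dotp x y : R := \sum_(i < n) x ord0 i * y ord0 i.

Definition sqn x : R := dotp x x.

Lemma dotpC x y : dotp x y = dotp y x.
Proof. by apply: eq_bigr => i _; rewrite mulrC. Qed.

Lemma dotpDl x y z : dotp (x + y) z = dotp x z + dotp y z.
Proof. by rewrite -big_split/=; apply: eq_bigr => i _; rewrite mxE mulrDl. Qed.

Lemma dotpZl a x z : dotp (a *: x) z = a * dotp x z.
Proof. by rewrite mulr_sumr; apply: eq_bigr => i _; rewrite mxE mulrA. Qed.

Lemma dotpNl x z : dotp (- x) z = - dotp x z.
Proof. by rewrite -scaleN1r dotpZl mulN1r. Qed.

Lemma dotpBl x y z : dotp (x - y) z = dotp x z - dotp y z.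
Proof. by rewrite dotpDl dotpNl. Qed.

Lemma dotpDr x y z : dotp x (y + z) = dotp x y + dotp x z.
Proof. by rewrite dotpC dotpDl !(dotpC x). Qed.

Lemma dotpZr a x z : dotp x (a *: z) = a * dotp x z.
Proof. by rewrite dotpC dotpZl dotpC. Qed.

Lemma dotpNr x z : dotp x (- z) = - dotp x z.
Proof. by rewrite dotpC dotpNl dotpC. Qed.

Definition dotpE := (dotpDl, dotpDr, dotpNl, dotpNr, dotpZl, dotpZr).

Lemma dotp0l y : dotp 0 y = 0.
Proof. by rewrite /dotp big1// => i _; rewrite mxE mul0r. Qed.

Lemma sqn0 : sqn 0 = 0.
Proof. exact: dotp0l. Qed.

Lemma sqn_ge0 x : 0 <= sqn x.
Proof. by apply: sumr_ge0 => i _; rewrite -expr2 sqr_ge0. Qed.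

Lemma sqr_coord_le_sqn x i : x ord0 i ^+ 2 <= sqn x.
Proof.
rewrite /sqn /dotp (bigD1 i)//= -expr2 lerDl.
by apply: sumr_ge0 => j _; rewrite -expr2 sqr_ge0.
Qed.

Lemma sqn_eq0 x : (sqn x == 0) = (x == 0).
Proof.
apply/idP/eqP => [/eqP x0|->]; last first.
  by rewrite sqn0.
apply/rowP => i; rewrite mxE; apply/eqP; rewrite -sqrf_eq0.
by rewrite eq_le sqr_ge0 andbT -[leRHS]x0 sqr_coord_le_sqn.
Qed.

Lemma sqn_gt0 x : (0 < sqn x) = (x != 0).
Proof. by rewrite lt_def sqn_eq0 sqn_ge0 andbT. Qed.

Lemma sqnN x : sqn (- x) = sqn x.
Proof. by rewrite /sqn !dotpE opprK. Qed.

Lemma sqnZ a x : sqn (a *: x) = a ^+ 2 * sqn x.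
Proof. by rewrite /sqn !dotpE mulrA. Qed.

Lemma euclid_normE x : euclid_norm x = Num.sqrt (sqn x).
Proof. by congr Num.sqrt; apply: eq_bigr => i _; rewrite expr2. Qed.

Lemma continuous_coord (i : 'I_n) : continuous (fun x : 'rV[R]_n => x ord0 i).
Proof. exact: coord_continuous. Qed.

Lemma continuous_rowP (T : topologicalType) (f : T -> 'rV[R]_n) :
  (forall i, continuous (fun t : T => f t ord0 i)) -> continuous f.
Proof.
move=> cf t; apply/cvg_ballP => e e0.
have : \forall s \near t, forall j, ball (f t ord0 j) e (f s ord0 j).
  by apply: filter_forall => j; have /cvg_ballP/(_ e e0) := cf j t.
by apply: filterS => s fs; split => // i j; rewrite (ord1 i).
Qed.

Lemma continuous_dotp e : continuous (fun x => dotp x e).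
Proof.
rewrite /dotp; apply: continuous_sum => i x.
exact: (cvgM (@continuous_coord i x) (cvg_cst _)).
Qed.

Lemma continuous_sqnB y : continuous (fun x => sqn (x - y)).
Proof.
rewrite /sqn /dotp; apply: continuous_sum => i.
have xy : continuous (fun x : 'rV[R]_n => (x - y) ord0 i).
  under eq_fun do rewrite !mxE.
  move=> x.
  exact: (cvgB (@continuous_coord i x) (cvg_cst _)).
by move=> x; exact: (cvgM (xy x) (xy x)).
Qed.

Lemma open_dotp_lt e m : open [set x | dotp x e < m].
Proof.
apply: (@open_comp _ _ (fun x => dotp x e) [set r | r < m]) => [x _|].
  exact: continuous_dotp.
exact: open_lt.
Qed.

Lemma open_dotp_gt e m : open [set x | m < dotp x e].
Proof.
apply: (@open_comp _ _ (fun x => dotp x e) [set r | m < r]) => [x _|].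
  exact: continuous_dotp.
exact: open_gt.
Qed.

Lemma open_sqnB_lt y a : open [set x | sqn (x - y) < a].
Proof.
apply: (@open_comp _ _ (fun x => sqn (x - y)) [set r | r < a]) => [x _|].
  exact: continuous_sqnB.
exact: open_lt.
Qed.

Lemma continuous_line x v : continuous (fun s : R => x + s *: v).
Proof.
move=> s; apply: cvgD; first exact: cvg_cst.
by apply: cvgZ; [exact: cvg_id|exact: cvg_cst].
Qed.

(** The reflection in the hyperplane [dotp x e = m], for a unit vector [e]. *)
Definition refl e m x := x - (2 * (dotp x e - m)) *: e.

Lemma refl_level e m x : refl e m x = refl e 0 x + (2 * m) *: e.
Proof. by apply/rowP => i; rewrite /refl !mxE; ring. Qed.

Lemma continuous_refl e m : continuous (refl e m).
Proof.
apply: continuous_rowP => i; under eq_fun do rewrite !mxE.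
move=> x; apply: (cvgB (@continuous_coord i x)).
apply: (cvgM _ (cvg_cst _)); apply: (cvgM (cvg_cst _)).
exact: (cvgB (@continuous_dotp e x) (cvg_cst _)).
Qed.

Lemma cvg_reflection T (F : set_system T) {FF : Filter F} (m_ : T -> R) (x_ : T -> 'rV[R]_n) e m x :
  m_ @ F --> m -> x_ @ F --> x -> refl e (m_ j) (x_ j) @[j --> F] --> refl e m x.
Proof.
move=> mm xx; rewrite refl_level; under eq_fun do rewrite refl_level.
apply: cvgD; first exact: (continuous_cvg _ (@continuous_refl e 0 x) xx).
by apply: cvgZ; [apply: cvgM => //; exact: cvg_cst|exact: cvg_cst].
Qed.

Lemma continuous_refl_level e x : continuous (fun m : R => refl e m x).
Proof.
under eq_fun do rewrite refl_level.
move=> m; apply: cvgD; first exact: cvg_cst.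
by apply: cvgZ; [apply: cvgM; [exact: cvg_cst|exact: cvg_id]|exact: cvg_cst].
Qed.

Section unit_direction.
Variables (e : 'rV[R]_n) (e1 : dotp e e = 1).

Lemma dotp_refl m x : dotp (refl e m x) e = 2 * m - dotp x e.
Proof. rewrite /refl !dotpE e1; ring. Qed.

Lemma reflK m : involutive (refl e m).
Proof.
move=> x; apply/rowP => i; rewrite {1}/refl dotp_refl /refl !mxE; ring.
Qed.

Lemma reflB m x y : refl e m x - refl e m y = refl e 0 (x - y).
Proof. by apply/rowP => i; rewrite /refl !dotpE !mxE; ring. Qed.

Lemma reflD m x y : refl e m (x + y) = refl e m x + refl e 0 y.
Proof. by apply/rowP => i; rewrite /refl !dotpE !mxE; ring. Qed.

Lemma sqn_reflB m x y : sqn (refl e m x - refl e m y) = sqn (x - y).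
Proof. rewrite reflB /refl /sqn !dotpE e1 !(dotpC e); ring. Qed.

Lemma sqn_reflBl m x y : sqn (refl e m x - y) = sqn (x - refl e m y).
Proof. by rewrite -(sqn_reflB m) reflK. Qed.

Lemma sqnB_refl m x y :
  sqn (x - y) - sqn (refl e m x - y) = 4 * (dotp x e - m) * (m - dotp y e).
Proof. rewrite /refl /sqn !dotpE e1 !(dotpC e) (dotpC y x). ring. Qed.

Lemma refl_id m x : dotp x e = m -> refl e m x = x.
Proof. by move=> xm; rewrite /refl xm subrr mulr0 scale0r subr0. Qed.

End unit_direction.

End dot_product.

Section measurable_dot_product.
Variables (R : realType) (n : nat).
Implicit Types (x y e : 'rV[R]_n) (m : R).

Lemma measurable_dotp e : measurable_fun setT (fun x : 'rV[R]_n => dotp x e).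
Proof.
apply: measurable_sum => i.
by apply: measurable_funM => //; exact: measurable_coord.
Qed.

Lemma measurable_sqnB y : measurable_fun setT (fun x => sqn (y - x) : R).
Proof.
apply: measurable_sum => i; under eq_fun do rewrite !mxE.
by apply: measurable_funM; apply: measurable_funB => //; exact: measurable_coord.
Qed.

Lemma measurable_refl e m : measurable_fun setT (@refl R n e m).
Proof.
apply: measurable_fun_mx => i j; under eq_fun do rewrite !mxE.
apply: measurable_funB; first exact: measurable_coord.
apply: measurable_funM => //; apply: measurable_funM => //.
by apply: measurable_funB => //; exact: measurable_dotp.
Qed.

End measurable_dot_product.

(** * Reflection invariance of Lebesgue measure *)

Section reflection_invariance.
Variables (R : realType) (n : nat).

(** The uniqueness argument for Haar measure: by Tonelli, the integral of
    1_A(x + y) 1_G(y) can be computed by shifting x first, which gives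
    mu A * nu G, or by shifting y first, which gives nu A * mu (- G). *)
Lemma translation_invariant_proportional
    (mu nu : {sigma_finite_measure set 'rV[R]_n -> \bar R}) (A G : set 'rV[R]_n) :
  (forall v B, measurable B -> mu [set x : 'rV[R]_n | B (x + v)] = mu B) ->
  (forall v B, measurable B -> nu [set x : 'rV[R]_n | B (x + v)] = nu B) ->
  measurable A -> measurable G -> (forall x, G x -> G (- x)) ->
  (mu A * nu G = nu A * mu G)%E.
Proof.
move=> muT nuT mA mG GN.
pose E1 := [set p : 'rV[R]_n * 'rV[R]_n | A (p.1 + p.2) /\ G p.2].
pose E2 := [set p : 'rV[R]_n * 'rV[R]_n | A p.2 /\ G (p.2 + - p.1)].
have mE1 : measurable E1.
  by apply: measurableI; apply: measurable_preimageT => //; exact: measurable_rVD.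
have mE2 : measurable E2.
  apply: measurableI; apply: measurable_preimageT => //.
  apply: (measurableT_comp (@measurable_rVD R n)
     (g := fun p : 'rV[R]_n * 'rV[R]_n => (p.2, - p.1))).
  apply/measurable_fun_pairP; split; first exact: measurable_snd.
  by apply: (measurableT_comp (@measurable_rVN R n)); exact: measurable_fst.
have indE (E : set ('rV[R]_n * 'rV[R]_n)) : measurable E ->
    (\int[mu]_x nu (xsection E x) = \int[nu]_y mu (ysection E y))%E.
  move=> mE; have := @fubini_tonelli _ _ _ _ _ mu nu (fun p => (\1_E p)%:E).
  have -> : (\int[mu]_x \int[nu]_y (\1_E (x, y))%:E = \int[mu]_x nu (xsection E x))%E.
    apply: eq_integral => x _; rewrite -[in RHS](setIT (xsection E x)) -integral_indic//;
      last exact: measurable_xsection.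
    by apply: eq_integral => y _; rewrite !indicE mem_xsection.
  have -> : (\int[nu]_y \int[mu]_x (\1_E (x, y))%:E = \int[nu]_y mu (ysection E y))%E.
    apply: eq_integral => x _; rewrite -[in RHS](setIT (ysection E x)) -integral_indic//;
      last exact: measurable_ysection.
    by apply: eq_integral => y _; rewrite !indicE mem_ysection.
  by apply => //; apply/measurable_EFinP; exact: measurable_indic.
have -> : (mu A * nu G = \int[nu]_y mu (ysection E1 y))%E.
  rewrite -[in LHS](setIT G) -integral_indic// -ge0_integralZl//; last first.
    by apply/measurable_EFinP; exact: measurable_indic.
  apply: eq_integral => y _; rewrite indicE; have [Gy|Gy] := pselect (G y).
    rewrite mem_set// mule1 -(muT y)//; congr (mu _).
    by apply/seteqP; split => x; rewrite /ysection/= inE //= => -[].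
  rewrite memNset// mule0 (_ : ysection _ _ = set0) ?measure0//.
  by apply/seteqP; split => x //; rewrite /ysection/= inE /= => -[].
have -> : (nu A * mu G = \int[nu]_y mu (ysection E2 y))%E.
  rewrite muleC -[in LHS](setIT A) -integral_indic// -ge0_integralZl//; last first.
    by apply/measurable_EFinP; exact: measurable_indic.
  apply: eq_integral => y _; rewrite indicE; have [Ay|Ay] := pselect (A y).
    rewrite mem_set// mule1 -(muT (- y))//; congr (mu _).
    apply/seteqP; split => x; rewrite /ysection/= inE /=.
      by move=> /GN; rewrite opprD opprK addrC.
    by move=> [_ /GN]; rewrite opprD opprK addrC.
  rewrite memNset// mule0 (_ : ysection _ _ = set0) ?measure0//.
  by apply/seteqP; split => x //; rewrite /ysection/= inE /= => -[].
rewrite -!indE//; apply: eq_integral => x _.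
rewrite -[RHS](nuT x); last exact: measurable_xsection.
congr (nu _); apply/seteqP; split => y; rewrite /xsection/= !inE/=.
  by rewrite /E1 /E2/= addrK (addrC y).
by rewrite /E1 /E2/= addrK (addrC y).
Qed.

Lemma lebesgue_rV_open_gt0 (U : set 'rV[R]_n) x : open U -> U x ->
  (0 < lebesgue_rV R n U)%E.
Proof.
move=> oU Ux; have /nbhs_ballP[r/= r0 rU] : nbhs x U by exact: open_nbhs_nbhs.
apply: (@lt_le_trans _ _ (lebesgue_rV R n (ball x r))).
  by rewrite lebesgue_rV_ball// lte_fin exprn_gt0// pmulrn_lgt0.
apply: le_measure; rewrite ?inE//; first exact: measurable_rV_ball.
exact: measurable_rV_open.
Qed.

Lemma lebesgue_rV_null_interior (U N : set 'rV[R]_n) x :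
  open U -> measurable N -> lebesgue_rV R n N = 0%E -> U `<=` N -> ~ U x.
Proof.
move=> oU mN N0 UN Ux; have := lebesgue_rV_open_gt0 oU Ux.
apply/negP; rewrite -leNgt -[leRHS]N0.
by apply: le_measure; rewrite ?inE//; exact: measurable_rV_open.
Qed.

(** The image of Lebesgue measure under a linear reflection is again translation
    invariant, hence proportional to it; Euclidean balls around the origin are
    fixed by the reflection, so the factor is 1. *)
Lemma lebesgue_rV_refl (e : 'rV[R]_n) m (A : set 'rV[R]_n) : dotp e e = 1 ->
  measurable A -> lebesgue_rV R n (refl e m @^-1` A) = lebesgue_rV R n A.
Proof.
move=> e1.
have mr k := @measurable_refl R n e k.
suff refl0 B : measurable B -> lebesgue_rV R n (refl e 0 @^-1` B) = lebesgue_rV R n B.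
  move=> mA; rewrite -(lebesgue_rVD ((2 * m) *: e) mA) -[RHS]refl0; last first.
    exact: (measurable_preimageT (measurable_rV_shift _)).
  congr (lebesgue_rV R n _); apply/seteqP; split => x /=.
    by rewrite refl_level.
  by rewrite [refl e m x]refl_level.
move=> mB.
(* Balls are needed at all radii, to see that the image measure is sigma-finite. *)
pose G k := [set x : 'rV[R]_n | sqn x < k.+1%:R].
have oG k : open (G k).
  have := @open_sqnB_lt R n 0 k.+1%:R; congr open.
  by apply/seteqP; split => x; rewrite /G/= subr0.
have mG k : measurable (G k) by exact: measurable_rV_open.
pose nu := pushforward (lebesgue_rV R n) (refl e 0).
have [nu0 nu0E] : exists nu' : {measure set 'rV[R]_n -> \bar R}, nu = nu' :> (set _ -> _).
  by unshelve (eexists (nu : {measure set _ -> \bar R}); reflexivity).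
have G_fin k : (lebesgue_rV R n (G k) < +oo)%E.
  apply: (@le_lt_trans _ _ (lebesgue_rV R n (ball (0 : 'rV[R]_n) k.+1%:R))).
    apply: le_measure; rewrite ?inE//; first exact: measurable_rV_ball.
    move=> x Gx; split => // i j; rewrite (ord1 i) mxE /ball/= sub0r normrN.
    rewrite -(@ltr_pXn2r _ 2)// ?nnegrE//; rewrite real_normK ?num_real//.
    apply: le_lt_trans (sqr_coord_le_sqn _ _) _; apply: lt_le_trans Gx _.
    by rewrite expr2 ler_peMl// ler1n.
  by rewrite [ltLHS](lebesgue_rV_ball (0 : 'rV[R]_n) (ltr0Sn R k)) ltry.
have nuG k : nu (G k) = lebesgue_rV R n (G k).
  congr (lebesgue_rV R n _); apply/seteqP; split => x; rewrite /G/=;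
    by have := sqn_reflB e1 0 x 0; rewrite [refl e 0 0]refl_id ?subr0 ?dotp0l// => ->.
have nu_fin : sigma_finite setT nu0.
  exists G.
    apply/seteqP; split => // v _; exists (Num.truncn (sqn v)) => //=.
    exact: truncnS_gt.
  by move=> k; split => //; rewrite -nu0E nuG.
have [nu1 nu1E] := bundle_sigma_finite nu_fin.
have nuE D : nu1 D = lebesgue_rV R n (refl e 0 @^-1` D) by rewrite -nu1E -nu0E.
have := @translation_invariant_proportional (lebesgue_rV R n) nu1 B (G 0%N).
rewrite !nuE [lebesgue_rV R n (_ @^-1` G _)]nuG => H.
have {}H : (lebesgue_rV R n B * lebesgue_rV R n (G 0%N) =
            lebesgue_rV R n (refl e 0 @^-1` B) * lebesgue_rV R n (G 0%N))%E.
  apply: H => //.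
  - by move=> v D; exact: lebesgue_rVD.
  - move=> v D mD; rewrite !nuE -(lebesgue_rVD (refl e 0 v) (measurable_preimageT (mr 0) mD)).
    congr (lebesgue_rV R n _); apply/seteqP; split => x /=.
      by rewrite reflD reflK.
    by rewrite reflD reflK.
  - by move=> x; rewrite /G/= sqnN.
have G0 : (0 < lebesgue_rV R n (G 0%N))%E.
  by apply: (@lebesgue_rV_open_gt0 _ 0) => //; rewrite /G/= sqn0.
have Gf : lebesgue_rV R n (G 0%N) \is a fin_num by rewrite ge0_fin_numE.
by apply/eqP; rewrite eq_le -(lee_pmul2r Gf G0) H lexx/= -(lee_pmul2r Gf G0) H.
Qed.

End reflection_invariance.

(** * Uniformly integrable sequences *)

Section vitali.
Context d (T : measurableType d) (R : realType) (mu : {measure set T -> \bar R}).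
Variable D : set T.
Hypotheses (mD : measurable D) (muD : (mu D < +oo)%E).

Definition excess (M x : R) : R := Num.max (`|x| - M) 0.

Definition clip (M x : R) : R := Num.max (- M) (Num.min x M).

Lemma excess_ge0 M x : 0 <= excess M x.
Proof. by rewrite /excess le_max lexx orbT. Qed.

Lemma norm_le_excess M x : `|x| <= M + excess M x.
Proof. by rewrite /excess; have [] := leP (`|x| - M) 0; lra. Qed.

Lemma normB_clip M x : 0 <= M -> `|x - clip M x| = excess M x.
Proof.
move=> M0; rewrite /clip /excess.
have [xM|xM] := leP x M.
  have [Mx|Mx] := leP (- M) x.
    rewrite subrr normr0; apply/esym/max_idPr; rewrite subr_le0 ler_norml; lra.
  have -> : `|x| = - x by rewrite ltr0_norm//; lra.
  by rewrite ltr0_norm ?max_l; lra.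
have -> : `|x| = x by rewrite gtr0_norm//; lra.
by rewrite (@max_r _ _ (- M) M) ?gtr0_norm ?max_l; lra.
Qed.

Lemma norm_clip_le M x : 0 <= M -> `|clip M x| <= M.
Proof.
move=> M0; rewrite /clip ler_norml; have [xM|xM] := leP x M.
  by have [?|?] := leP (- M) x; apply/andP; split; lra.
by have [?|?] := leP (- M) M; apply/andP; split; lra.
Qed.

Lemma continuous_clip M : continuous (clip M).
Proof.
apply: (@max_fun_continuous _ R R (fun=> - M) (fun x => Num.min x M)).
  exact: cst_continuous.
by apply: (@min_fun_continuous _ R R id (fun=> M)) => x; [exact: cvg_id|exact: cvg_cst].
Qed.

Lemma continuous_excess M : continuous (excess M).
Proof.
apply: (@max_fun_continuous _ R R (fun x => `|x| - M) (fun=> 0)).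
  by move=> x; exact: (cvgB (@norm_continuous _ _ x) (cvg_cst _)).
exact: cst_continuous.
Qed.

Lemma measurable_excess M (g : T -> R) : measurable_fun D g ->
  measurable_fun D (fun x => excess M (g x)).
Proof.
move=> mg; apply: measurable_maxr => //; apply: measurable_funB => //.
exact: measurableT_comp.
Qed.

Lemma measurable_clip M (g : T -> R) : measurable_fun D g ->
  measurable_fun D (fun x => clip M (g x)).
Proof. by move=> mg; apply: measurable_maxr => //; exact: measurable_minr. Qed.

Lemma integrable_clip M (g : T -> R) : 0 <= M -> measurable_fun D g ->
  mu.-integrable D (EFin \o (fun x => clip M (g x))).
Proof.
move=> M0 mg; apply: measurable_bounded_integrable => //.
  exact: measurable_clip.
exists M; split => [|y My x Dx]; first exact: num_real.
by apply: le_trans (ltW My); exact: norm_clip_le.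
Qed.

Lemma integral_clip (g : T -> R) (M eps : R) : 0 <= M -> measurable_fun D g ->
  (\int[mu]_(x in D) (excess M (g x))%:E <= eps%:E)%E ->
  mu.-integrable D (EFin \o g) /\
  `|\int[mu]_(x in D) g x - \int[mu]_(x in D) clip M (g x)| <= eps.
Proof.
move=> M0 mg geps.
have mex : measurable_fun D (fun x => (excess M (g x))%:E).
  by apply/measurable_EFinP; exact: measurable_excess.
have ig : mu.-integrable D (EFin \o g).
  apply/integrableP; split; first exact/measurable_EFinP.
  apply: (@le_lt_trans _ _ (\int[mu]_(x in D) (M%:E + (excess M (g x))%:E))%E).
    apply: ge0_le_integral => //.
    - by do 2 apply: measurableT_comp => //; exact/measurable_EFinP.
    - exact: emeasurable_funD.
    - by move=> x _; rewrite /= -EFinD lee_fin norm_le_excess.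
  rewrite ge0_integralD//; last by move=> x _; rewrite lee_fin excess_ge0.
  rewrite integral_cst//; apply: lte_add_pinfty; last first.
    by apply: le_lt_trans geps _; rewrite ltry.
  by apply: lte_mul_pinfty => //; rewrite lee_fin.
split => //; have ic := integrable_clip M0 mg.
rewrite -RintegralB//; apply: le_trans (le_normr_Rintegral _ _) _ => //.
  exact: (integrableB mD ig ic).
under eq_Rintegral do rewrite normB_clip//.
rewrite -lee_fin fineK// ge0_fin_numE.
  by apply: le_lt_trans geps _; rewrite ltry.
by apply: integral_ge0 => x _; rewrite lee_fin excess_ge0.
Qed.

(** Truncating at level M moves each integral by at most the integral of the
    excess over M, which is small uniformly in k; Fatou's lemma transfers that
    bound to the limit. The truncated functions converge by domination. *)
Lemma vitali_convergence (f_ : nat -> T -> R) (f : T -> R) :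
  (forall k, measurable_fun D (f_ k)) ->
  (forall x, D x -> f_ ^~ x @ \oo --> f x) ->
  (forall eps, 0 < eps -> exists2 M, 0 <= M &
    forall k, (\int[mu]_(x in D) (excess M (f_ k x))%:E <= eps%:E)%E) ->
  mu.-integrable D (EFin \o f) /\
  \int[mu]_(x in D) f_ k x @[k --> \oo] --> \int[mu]_(x in D) f x.
Proof.
move=> mf_ f_f ui.
have mf : measurable_fun D f by exact: measurable_fun_cvg mf_ f_f.
have uif M eps : (forall k, (\int[mu]_(x in D) (excess M (f_ k x))%:E <= eps%:E)%E) ->
    (\int[mu]_(x in D) (excess M (f x))%:E <= eps%:E)%E.
  move=> Meps.
  have -> : (\int[mu]_(x in D) (excess M (f x))%:E =
      \int[mu]_(x in D) limn_einf (fun k => (excess M (f_ k x))%:E))%E.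
    apply: eq_integral => x /set_mem Dx.
    have ex : (excess M (f_ k x))%:E @[k --> \oo] --> (excess M (f x))%:E.
      apply: cvg_EFin; first exact: nearW.
      exact: (continuous_cvg _ (@continuous_excess M _) (f_f x Dx)).
    by have [-> _] := cvg_limn_einf_sup ex.
  apply: le_trans (fatou _ _ _ _) _ => //.
  - by move=> k; apply/measurable_EFinP; exact: measurable_excess.
  - by move=> k x _; rewrite lee_fin excess_ge0.
  rewrite limn_einf_lim; apply: lime_le; first exact: is_cvg_einfs.
  apply: nearW => k; apply: le_trans (Meps k).
  by apply: ereal_inf_lbound; exists k => /=.
split.
  have [M M0 /uif Mf] := ui 1 ltr01.
  by have [] := integral_clip M0 mf Mf.
apply/cvgrPdist_le => eps eps0.
have e3 : 0 < eps / 3 by rewrite divr_gt0.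
have [M M0 Mf_] := ui _ e3; have Mf := uif _ _ Mf_.
have [if_ fc] := integral_clip M0 mf Mf.
have cc : \int[mu]_(x in D) clip M (f_ k x) @[k --> \oo] --> \int[mu]_(x in D) clip M (f x).
  have [] := @dominated_convergence _ T R mu D mD (fun k x => (clip M (f_ k x))%:E)
    (fun x => (clip M (f x))%:E) (fun=> M%:E).
  - by move=> k; apply/measurable_EFinP; exact: measurable_clip.
  - by apply/measurable_EFinP; exact: measurable_clip.
  - apply: aeW => x Dx; apply: cvg_EFin; first exact: nearW.
    exact: (continuous_cvg _ (@continuous_clip M _) (f_f x Dx)).
  - apply: (@measurable_bounded_integrable _ _ _ mu (fun=> M)) => //.
    by exists M; split; [exact: num_real|move=> y My x Dx; rewrite ger0_norm// ltW].
  - by apply: aeW => x k Dx; rewrite lee_fin norm_clip_le.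
  move=> ic _ cc; apply: fine_cvg.
  by rewrite fineK//; exact: (integrable_fin_num mD ic).
move/cvgrPdist_le/(_ _ e3) : cc; apply: filterS => k ck.
have [_ fkc] := integral_clip M0 (mf_ k) (Mf_ k).
move: ck fc fkc; rewrite !ler_norml; lra.
Qed.

End vitali.

(** * Uniform integrability of the singular kernel *)

Section singular_kernel.
Variables (R : realType) (n : nat).
Implicit Types (a b y : 'rV[R]_n.+1).

Lemma euclid_norm_ge0 m (x : 'rV[R]_m) : 0 <= euclid_norm x.
Proof. exact: sqrtr_ge0. Qed.

Lemma sqr_euclid_norm m (x : 'rV[R]_m) : euclid_norm x ^+ 2 = sqn x.
Proof. by rewrite euclid_normE sqr_sqrtr// sqn_ge0. Qed.

Lemma euclid_norm_gt0 m (x : 'rV[R]_m) : (0 < euclid_norm x) = (x != 0).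
Proof. by rewrite euclid_normE sqrtr_gt0 sqn_gt0. Qed.

Lemma coord_le_euclid_norm m (x : 'rV[R]_m) i : `|x ord0 i| <= euclid_norm x.
Proof.
rewrite -(@ler_pXn2r _ 2)// ?nnegrE ?euclid_norm_ge0//.
by rewrite sqr_euclid_norm real_normK ?num_real// sqr_coord_le_sqn.
Qed.

Lemma measurable_inv_dist a : measurable_fun setT (fun y => euclid_norm (a - y) ^- n).
Proof.
under eq_fun do rewrite -powR_invn ?euclid_norm_ge0// euclid_normE -powR12_sqrt ?sqn_ge0//.
apply: (measurableT_comp (measurable_powR _)).
apply: (measurableT_comp (measurable_powR _)).
exact: measurable_sqnB.
Qed.

(** Dyadic summation. Where 2^-(j+1) <= |a - y| < 2^-j the kernel is at most
    2^((j+1)n), and the cube of half-side 2^-j has volume (2^(1-j))^(n+1), so the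
    contribution of scale j is of order 2^-j; only the scales j >= J exceed the
    level 2^(Jn). The centre a does not enter the bound. *)
Lemma excess_inv_dist_le a J :
  (\int[lebesgue_rV R n.+1]_y
     (excess (2 ^+ (J * n)) (euclid_norm (a - y) ^- n))%:E <=
   (2 ^+ (n.*2.+2) / 2 ^+ J)%:E)%E.
Proof.
pose rho i : R := (2 ^+ (J + i))^-1.
have rho0 i : 0 < rho i by rewrite invr_gt0 exprn_gt0.
pose g i y : \bar R := ((2 ^+ ((J + i).+1 * n)) * \1_(ball a (rho i)) y)%:E.
have g0 i y : (0 <= g i y)%E by rewrite lee_fin mulr_ge0// exprn_ge0.
have mg i : measurable_fun setT (g i).
  apply/measurable_EFinP; apply: measurable_funM => //.
  by apply: measurable_indic; exact: measurable_rV_ball.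
apply: (@le_trans _ _ (\int[lebesgue_rV R n.+1]_y \sum_(i <oo) g i y)%E).
  apply: ge0_le_integral => //.
  - by move=> y _; rewrite lee_fin excess_ge0.
  - apply/measurable_EFinP; apply: measurable_excess; exact: measurable_inv_dist.
  - by apply: ge0_emeasurable_sum.
  move=> y _; set r := euclid_norm (a - y).
  have r0 : 0 <= r := euclid_norm_ge0 _.
  have [rJ|rJ] := leP (r ^- n) (2 ^+ (J * n)).
    rewrite /excess max_r ?nneseries_ge0//.
    by rewrite ger0_norm ?invr_ge0 ?exprn_ge0// subr_le0.
  (* At r = 0 the inverse power is 0, or 1 if n = 0, which is below the level. *)
  have {}r0 : 0 < r.
    rewrite lt_def r0 andbT; apply/eqP => r00; move: rJ; rewrite r00.
    case: (n) => [|k]; first by rewrite muln0 !expr0 invr1 ltxx.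
    by rewrite expr0n/= invr0 ltNge exprn_ge0.
  have rrho0 : r < rho 0%N.
    rewrite ltNge; apply/negP => rr; move: rJ; apply/negP; rewrite -leNgt.
    rewrite exprM -[leRHS]invrK lef_pV2 ?posrE ?invr_gt0 ?exprn_gt0// -exprVn.
    by apply: lerXn2r; rewrite ?nnegrE ?invr_ge0 ?exprn_ge0 ?(ltW r0)// -[J]addn0.
  have ex_rho : exists k, rho k <= r.
    exists (Num.truncn r^-1).+1; rewrite -[leRHS]invrK lef_pV2 ?posrE ?invr_gt0 ?exprn_gt0//.
    apply: le_trans (ltW (truncnS_gt _)) _; rewrite -natrX ler_nat.
    by apply: leq_trans (ltnW (ltn_expl _ (isT : (1 < 2)%N))) _; rewrite leq_exp2l ?leq_addl.
  have [i ri] : exists i, (rho i.+1 <= r) && (r < rho i).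
    case: (ex_minnP ex_rho) => -[|k] rk kmin; first by move: rrho0; rewrite ltNge rk.
    exists k; rewrite rk/= ltNge; apply/negP => /kmin; by rewrite ltnn.
  have {ri}[ri1 ri2] := andP ri.
  have giE : (g i y = (2 ^+ ((J + i).+1 * n))%:E)%E.
    rewrite /g indicE mem_set ?mulr1//; split => // k j; rewrite (ord1 k).
    by apply: le_lt_trans ri2; have := coord_le_euclid_norm (a - y) j; rewrite !mxE.
  apply: (@le_trans _ _ (g i y)).
    rewrite giE lee_fin; apply: (@le_trans _ _ (r ^- n)).
      rewrite /excess ge_max invr_ge0 exprn_ge0 ?(ltW r0)// andbT.
      rewrite ger0_norm ?invr_ge0 ?exprn_ge0 ?(ltW r0)//.
      by rewrite lerBlDr lerDl exprn_ge0.
    rewrite exprM -[leRHS]invrK lef_pV2 ?posrE ?invr_gt0 ?exprn_gt0// -exprVn.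
    by apply: lerXn2r; rewrite ?nnegrE ?invr_ge0 ?exprn_ge0 ?(ltW r0)// -addnS.
  apply: le_trans (nneseries_lim_ge i.+1 _); last by move=> k _ _; exact: g0.
  by rewrite big_nat_recr//= leeDr// sume_ge0.
rewrite integral_nneseries//.
apply: le_trans (epsilon_trick0 xpredT _); last first.
  by rewrite mulr_ge0// ?invr_ge0 exprn_ge0.
apply: lee_nneseries => i _.
  by move=> _; apply: integral_ge0.
rewrite /g; under eq_integral do rewrite EFinM.
rewrite ge0_integralZl_EFin//; last first.
  by apply/measurable_EFinP; apply: measurable_indic; exact: measurable_rV_ball.
rewrite integral_indic//; last exact: measurable_rV_ball.
rewrite setIT [X in (_ * X)%E](lebesgue_rV_ball a (rho0 i)) -EFinM lee_fin.
rewrite /rho natrX exprM exprS.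
have -> : 2 ^+ n.*2.+2 / 2 ^+ J / 2 ^+ i.+1 = 4 * (2 ^+ n * 2 ^+ n) / (2 * 2 ^+ (J + i)) :> R.
  rewrite -addnn !exprS !exprD; field.
  by rewrite !expf_neq0.
have q0 : 2 ^+ (J + i) != 0 :> R by rewrite expf_neq0.
move: (2 ^+ (J + i)) q0 => q q0; rewrite -[q^-1 *+ 2]mulr_natr exprMn exprS exprMn exprVn.
have qn : q ^+ n != 0 by rewrite expf_neq0.
move: (2 ^+ n) (q ^+ n) qn => p s s0.
rewrite le_eqVlt; apply/orP; left; apply/eqP; field.
by rewrite q0 s0.
Qed.

Lemma excessM (C M x : R) : 0 <= C -> excess (C * M) (C * x) = C * excess M x.
Proof.
by move=> C0; rewrite /excess normrM (ger0_norm C0) -mulrBr maxr_pMr// mulr0.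
Qed.

Lemma excess_le_add (M A B x : R) : 0 <= M -> 0 <= A -> 0 <= B -> `|x| <= A + B ->
  excess (M + M) x <= excess M A + excess M B.
Proof.
move=> M0 A0 B0 xAB; rewrite /excess (ger0_norm A0) (ger0_norm B0).
by have [?|?] := leP (`|x| - (M + M)) 0; have [?|?] := leP (A - M) 0;
  have [?|?] := leP (B - M) 0; lra.
Qed.

Lemma excess_inv_dist_small (C eps : R) : 0 <= C -> 0 < eps ->
  exists2 M, 0 <= M & forall a,
    (\int[lebesgue_rV R n.+1]_y
       (excess M (C * euclid_norm (a - y) ^- n))%:E <= eps%:E)%E.
Proof.
move=> C0 eps0; pose K : R := 2 ^+ n.*2.+2.
have K0 : 0 <= K by rewrite exprn_ge0.
pose J := Num.truncn (C * K / eps).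
exists (C * 2 ^+ (J * n)); first by rewrite mulr_ge0// exprn_ge0.
move=> a; under eq_integral do rewrite excessM// EFinM.
rewrite ge0_integralZl_EFin//; last first.
- by apply/measurable_EFinP; apply: measurable_excess; exact: measurable_inv_dist.
- by move=> y _; rewrite lee_fin excess_ge0.
apply: le_trans (lee_wpmul2l _ (excess_inv_dist_le a J)) _; first by rewrite lee_fin.
rewrite -EFinM lee_fin mulrA ler_pdivrMr ?exprn_gt0// -ler_pdivrMl// mulrC.
have := truncnS_gt (C * K / eps); rewrite -/J => /ltW/le_trans; apply.
by rewrite -natrX ler_nat ltn_expl.
Qed.

(** The form in which uniform integrability is used: one level M serves all
    functions dominated by two poles, wherever the poles are. *)
Lemma excess_dominated_small (C eps : R) : 0 <= C -> 0 < eps ->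
  exists2 M, 0 <= M & forall (D : set 'rV[R]_n.+1) (g : 'rV[R]_n.+1 -> R) a b,
    measurable D -> measurable_fun D g ->
    (forall y, D y -> `|g y| <= C * (euclid_norm (a - y) ^- n + euclid_norm (b - y) ^- n)) ->
    (\int[lebesgue_rV R n.+1]_(y in D) (excess M (g y))%:E <= eps%:E)%E.
Proof.
move=> C0 eps0; have e2 : 0 < eps / 2 by rewrite divr_gt0.
have [M M0 HM] := excess_inv_dist_small C0 e2.
exists (M + M); first by rewrite addr_ge0.
move=> D g a b mD mg gab.
have w0 c y : 0 <= C * euclid_norm (c - y) ^- n.
  by rewrite mulr_ge0// invr_ge0 exprn_ge0// euclid_norm_ge0.
have mw c : measurable_fun setT (fun y => (excess M (C * euclid_norm (c - y) ^- n))%:E).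
  apply/measurable_EFinP; apply: measurable_excess; apply: measurable_funM => //.
  exact: measurable_inv_dist.
have mwD c : measurable_fun D (fun y => (excess M (C * euclid_norm (c - y) ^- n))%:E).
  exact: measurable_funTS.
have iD c : (\int[lebesgue_rV R n.+1]_(y in D) (excess M (C * euclid_norm (c - y) ^- n))%:E
    <= (eps / 2)%:E)%E.
  apply: le_trans (HM c); apply: ge0_subset_integral => //.
  by move=> y _; rewrite lee_fin excess_ge0.
apply: (@le_trans _ _ (\int[lebesgue_rV R n.+1]_(y in D)
   ((excess M (C * euclid_norm (a - y) ^- n))%:E +
    (excess M (C * euclid_norm (b - y) ^- n))%:E))%E).
  apply: ge0_le_integral => //.
  - by move=> y _; rewrite lee_fin excess_ge0.
  - by apply/measurable_EFinP; exact: measurable_excess.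
  - exact: emeasurable_funD.
  - by move=> y Dy; rewrite -EFinD lee_fin excess_le_add// -mulrDr gab.
rewrite ge0_integralD//; [|by move=> y _; rewrite lee_fin excess_ge0..].
by apply: le_trans (leeD (iD a) (iD b)) _; rewrite -EFinD lee_fin -splitr.
Qed.

End singular_kernel.

(** * The radial kernel *)

Section box_cox.
Variable R : realType.
Implicit Types (g s a b r : R).

(** The Box-Cox transform: a primitive of the power g - 1 on the positive reals.
    It turns the three kernels (logarithm, negative power, positive power) into
    one increasing function, up to a nonzero factor. *)
Definition box_cox g s : R := if g == 0 then ln s else s `^ g / g.

Lemma is_derive_box_cox g s : 0 < s -> is_derive s 1 (box_cox g) (s `^ (g - 1)).
Proof.
move=> s0; rewrite /box_cox; have [->|g0] := eqVneq g 0.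
  by rewrite sub0r powR_inv1 ?ltW//; exact: is_derive1_ln.
have H := is_derive1_powR g s0.
have := @is_deriveM _ _ (@powR R ^~ g) (fun=> g^-1) s 1 _ _ H (is_derive_cst _ _ _).
by rewrite scaler0 add0r -[X in is_derive _ _ _ X]/(g^-1 * (g * s `^ (g - 1))) mulKf.
Qed.

Lemma continuous_box_cox g s : 0 < s -> {for s, continuous (box_cox g)}.
Proof.
move=> s0; apply: differentiable_continuous; apply/derivable1_diffP.
by have [] := is_derive_box_cox g s0.
Qed.

Lemma measurable_box_cox g : measurable_fun setT (box_cox g).
Proof.
rewrite /box_cox; case: eqP => _; first exact: measurable_ln.
by apply: measurable_funM => //; exact: measurable_powR.
Qed.

Lemma MVT_box_cox g a b : 0 < a -> a < b ->
  exists2 c, a < c < b & box_cox g b - box_cox g a = c `^ (g - 1) * (b - a).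
Proof.
move=> a0 ab; have [|| c cab E] := @MVT R (box_cox g) (fun s => s `^ (g - 1)) a b ab.
- by move=> x; rewrite in_itv/= => /andP[ax _]; apply: is_derive_box_cox; exact: lt_trans ax.
- apply: derivable_within_continuous => x; rewrite in_itv/= => /andP[ax _].
  by have [] := is_derive_box_cox g (lt_le_trans a0 ax).
by exists c.
Qed.

Lemma box_cox_sqr g r : 0 < r -> box_cox g (r ^+ 2) = 2 * box_cox (2 * g) r.
Proof.
move=> r0; rewrite /box_cox mulf_eq0 pnatr_eq0/=; case: eqP => [_|/eqP g0].
  by rewrite lnXn// mulr_natl.
by rewrite -powR_mulrn ?ltW// -powRrM; field.
Qed.

(** At the mean value c the derivative is c^(g-1+n) c^-n; the first factor is at
    most its value at r, and c^-n is below one of a^-n, b^-n. *)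
Lemma box_cox_lip n g a b r : 0 <= g - 1 + n%:R -> 0 < a <= r -> 0 < b <= r ->
  `|box_cox g a - box_cox g b| <= r `^ (g - 1 + n%:R) * `|a - b| * (a ^- n + b ^- n).
Proof.
move=> gn; wlog ab : a b / a < b => [H ar br|/andP[a0 ar] /andP[b0 br]].
  have [ab|ba|<-] := ltgtP a b; first exact: H.
    by rewrite distrC (distrC a) [X in _ * X]addrC H.
  by rewrite !subrr normr0 mulr0 mul0r.
have [c /andP[ac cb] E] := MVT_box_cox g a0 ab; have c0 := lt_trans a0 ac.
rewrite distrC E normrM (distrC a) [leRHS]mulrAC ler_wpM2r// ger0_norm ?powR_ge0//.
have -> : c `^ (g - 1) = c `^ (g - 1 + n%:R) * c ^- n.
  rewrite (@powRD _ _ (g - 1)); last by rewrite (gt_eqF c0) implybT.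
  by rewrite powR_mulrn ?ltW// mulfK// expf_neq0// gt_eqF.
apply: ler_pM; rewrite ?powR_ge0 ?invr_ge0 ?exprn_ge0 ?(ltW c0)//.
  by rewrite ge0_ler_powR ?nnegrE ?(ltW c0) ?(ltW (lt_le_trans b0 br)) ?(ltW (lt_le_trans cb br)).
apply: (@le_trans _ _ (a ^- n)); last by rewrite lerDl invr_ge0 exprn_ge0 ?(ltW b0).
by rewrite lef_pV2 ?posrE ?exprn_gt0// lerXn2r ?nnegrE ?(ltW a0) ?(ltW c0) ?(ltW ac).
Qed.

(** The divided difference of [box_cox g], completed by the derivative on the
    diagonal so that it is continuous there. *)
Definition divided_diff g a b : R :=
  if a == b then a `^ (g - 1) else (box_cox g a - box_cox g b) / (a - b).

Lemma divided_diffE g a b : box_cox g a - box_cox g b = divided_diff g a b * (a - b).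
Proof.
rewrite /divided_diff; have [->|ab] := eqVneq a b; first by rewrite !subrr mulr0.
by rewrite divfK// subr_eq0.
Qed.

Lemma divided_diffC g a b : divided_diff g a b = divided_diff g b a.
Proof.
rewrite /divided_diff eq_sym; have [->//|ab] := eqVneq b a.
by rewrite -[in RHS]opprB -[b - a]opprB invrN mulrNN.
Qed.

Lemma divided_diff_mean g a b : 0 < a -> 0 < b ->
  exists2 c, Num.min a b <= c <= Num.max a b & divided_diff g a b = c `^ (g - 1).
Proof.
move=> a0 b0; wlog ab : a b a0 b0 / a < b => [H|].
  have [ab|/negP] := pselect (a < b); first exact: H.
  rewrite -leNgt le_eqVlt => /orP[/eqP<-|ba].
    by exists b; rewrite ?minxx ?maxxx ?lexx// /divided_diff eqxx.
  by have := H _ _ b0 a0 ba; rewrite divided_diffC minC maxC.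
have [c /andP[ac cb] E] := MVT_box_cox g a0 ab.
exists c; first by rewrite min_l ?max_r ?(ltW ac) ?(ltW cb)// ltW.
by rewrite divided_diffC /divided_diff gt_eqF// E mulfK// gt_eqF// subr_gt0.
Qed.

Lemma divided_diff_gt0 g a b : 0 < a -> 0 < b -> 0 < divided_diff g a b.
Proof.
move=> a0 b0; have [c /andP[abc _] ->] := divided_diff_mean g a0 b0.
by rewrite powR_gt0// (lt_le_trans _ abc)// lt_min a0.
Qed.

(** On the diagonal a = b the mean value form is used: it does not depend on
    whether the terms of the two sequences are equal. *)
Lemma divided_diff_cvg g (a_ b_ : nat -> R) a b : 0 < a -> 0 < b ->
  (forall k, 0 < a_ k) -> (forall k, 0 < b_ k) ->
  a_ @ \oo --> a -> b_ @ \oo --> b ->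
  divided_diff g (a_ k) (b_ k) @[k --> \oo] --> divided_diff g a b.
Proof.
move=> a0 b0 a_0 b_0 aa bb; have [ab|ab] := eqVneq a b.
  subst b.
  have /choice[c cE] : forall k, exists c,
      (Num.min (a_ k) (b_ k) <= c <= Num.max (a_ k) (b_ k)) /\
      divided_diff g (a_ k) (b_ k) = c `^ (g - 1).
    by move=> k; have [c ? ?] := divided_diff_mean g (a_0 k) (b_0 k); exists c.
  under eq_fun do rewrite (cE _).2.
  rewrite /divided_diff eqxx.
  have ca : c @ \oo --> a.
    apply/cvgrPdist_le => e e0.
    move/cvgrPdist_le/(_ e e0) : aa => aa; move/cvgrPdist_le/(_ e e0) : bb => bb.
    near=> k.
    have : `|a - a_ k| <= e by near: k.
    have : `|a - b_ k| <= e by near: k.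
    have [+ _] := cE k; rewrite !ler_norml.
    have [?|?] := leP (a_ k) (b_ k); move=> /andP[? ?] /andP[? ?] /andP[? ?];
      apply/andP; split; lra.
  have /differentiable_continuous cp : differentiable (@powR R ^~ (g - 1)) a.
    by apply/derivable1_diffP; have [] := is_derive1_powR (g - 1) a0.
  exact: (continuous_cvg _ cp ca).
rewrite {2}/divided_diff (negbTE ab).
have abk : \forall k \near \oo, a_ k != b_ k.
  have abB : a_ k - b_ k @[k --> \oo] --> a - b by exact: cvgB aa bb.
  have ab0 : 0 < `|a - b| by rewrite normr_gt0 subr_eq0.
  move/cvgrPdist_lt/(_ _ ab0) : abB; apply: filterS => k; apply: contraTneq => ->.
  by rewrite subrr subr0 ltxx.
have cq : (box_cox g (a_ k) - box_cox g (b_ k)) / (a_ k - b_ k) @[k --> \oo] -->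
    (box_cox g a - box_cox g b) / (a - b).
  apply: cvgM.
    apply: cvgB; [exact: (continuous_cvg _ (continuous_box_cox a0) aa)|].
    exact: (continuous_cvg _ (continuous_box_cox b0) bb).
  by apply: cvgV; [rewrite subr_eq0|exact: cvgB aa bb].
apply: cvg_trans cq; apply: near_eq_cvg; apply: filterS abk => k kab.
by rewrite /divided_diff (negbTE kab).
Unshelve. all: by end_near. Qed.

End box_cox.

(** * The potential of a bounded open set *)

Section potential_difference.
Variables (R : realType) (n : nat) (alpha : R) (Omega : set 'rV[R]_n.+1).
Hypotheses (alpha2 : 2 <= alpha) (oO : open Omega) (bO : bounded_set Omega).
Implicit Types (x y p e : 'rV[R]_n.+1) (m : R).

Let mu := lebesgue_rV R n.+1.
Let mO : measurable Omega := measurable_rV_open oO.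

Lemma lebesgue_rV_bounded_lty : (mu Omega < +oo)%E.
Proof.
have [M [Mr MO]] := bO.
have M0 : 0 < `|M| + 1 + 1 by rewrite ltr_wpDl.
apply: (@le_lt_trans _ _ (mu (ball (0 : 'rV[R]_n.+1) (`|M| + 1 + 1)))).
  apply: le_measure; rewrite ?inE//; first exact: measurable_rV_ball.
  move=> x Ox; rewrite -ball_normE/= sub0r normrN.
  apply: (@le_lt_trans _ _ (`|M| + 1)); last by rewrite ltrDl.
  by apply: (MO (`|M| + 1)) => //; rewrite (le_lt_trans (ler_norm _))// ltrDl.
by rewrite [ltLHS](lebesgue_rV_ball (0 : 'rV[R]_n.+1) M0) ltry.
Qed.

Lemma diameter_bound : exists2 r, 0 < r & forall x y, closure Omega x -> Omega y ->
  euclid_norm (x - y) <= r.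
Proof.
have [M [Mr MO]] := bO.
have M0 : 0 <= `|M| + 1 by rewrite addr_ge0.
have bM x : Omega x -> `|x| <= `|M| + 1.
  by apply: (MO (`|M| + 1)); rewrite (le_lt_trans (ler_norm _))// ltrDl.
set K := `|M| + 1 in M0 bM.
have K1 : 0 < K + K + 1 by rewrite ltr_wpDl// addr_ge0.
exists (Num.sqrt (n.+1%:R * (K + K + 1) ^+ 2)).
  by rewrite sqrtr_gt0 mulr_gt0// exprn_gt0.
move=> x y /(_ _ (nbhsx_ballx x _ ltr01)) [x' [Ox' xx']] Oy.
rewrite euclid_normE ler_wsqrtr// /sqn /dotp.
apply: (@le_trans _ _ (\sum_(i < n.+1) (K + K + 1) ^+ 2)); last first.
  by rewrite sumr_const card_ord mulr_natl.
apply: ler_sum => i _; rewrite -expr2 -[leLHS]real_normK ?num_real//.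
have xy : `|(x - y) ord0 i| <= K + K + 1.
  have : ball (0 : 'rV[R]_n.+1) (K + K + 1) (x - y).
    rewrite -ball_normE/= sub0r normrN.
    have -> : x - y = (x - x') + (x' - y) by rewrite addrA subrK.
    apply: le_lt_trans (ler_normD _ _) _; rewrite addrC; apply: ler_ltD.
      by apply: le_trans (ler_normB _ _) _; apply: lerD; exact: bM.
    by move: xx'; rewrite -ball_normE.
  by case=> _ /(_ ord0 i); rewrite /ball/= mxE sub0r normrN => /ltW.
by rewrite lerXn2r ?nnegrE// ltW.
Qed.

Lemma integrable_dominated (g : 'rV[R]_n.+1 -> R) (C : R) a b : 0 <= C ->
  measurable_fun Omega g ->
  (forall y, Omega y -> `|g y| <= C * (euclid_norm (a - y) ^- n + euclid_norm (b - y) ^- n)) ->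
  mu.-integrable Omega (EFin \o g).
Proof.
move=> C0 mg gab; have [M M0 H] := @excess_dominated_small R n C 1 C0 ltr01.
by have [] := integral_clip mO lebesgue_rV_bounded_lty M0 mg (H _ _ _ _ mO mg gab).
Qed.

(** The kernel is a power alpha - N of the distance, that is, half that power of
    the squared distance; squared distances are what reflections relate simply. *)
Definition kexp : R := (alpha - n.+1%:R) / 2.

Let kexpE : 2 * kexp - 1 + n%:R = alpha - 2.
Proof. by rewrite /kexp -[n.+1]addn1 natrD; field. Qed.

Let kexp_ge0 : 0 <= 2 * kexp - 1 + n%:R.
Proof. by rewrite kexpE subr_ge0. Qed.

Definition kernel_potential x : R := \int[mu]_(y in Omega) box_cox kexp (sqn (x - y)).

Let out_gt0 x y : ~ Omega x -> Omega y -> 0 < euclid_norm (x - y).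
Proof.
move=> Ox Oy; rewrite euclid_norm_gt0 subr_eq0; apply/eqP => xy.
by apply: Ox; rewrite xy.
Qed.

Lemma measurable_kernel x : measurable_fun setT (fun y => box_cox kexp (sqn (x - y))).
Proof. by apply: (measurableT_comp (@measurable_box_cox R kexp)); exact: measurable_sqnB. Qed.

(** [box_cox_lip] compares the kernel at distance a with its value at the diameter
    bound r, so that it is dominated by a multiple of a^-n. *)
Lemma integrable_kernel x : closure Omega x -> ~ Omega x ->
  mu.-integrable Omega (EFin \o (fun y => box_cox kexp (sqn (x - y)))).
Proof.
move=> cx nx; have [r r0 rO] := diameter_bound.
pose K := `|box_cox (2 * kexp) r| * r ^+ n + r `^ (2 * kexp - 1 + n%:R) * r.
have K0 : 0 <= K by rewrite addr_ge0// mulr_ge0 ?powR_ge0 ?exprn_ge0// ltW.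
apply: (@integrable_dominated _ (2 * K) x x).
- by rewrite mulr_ge0.
- exact: (measurable_funTS (measurable_kernel x)).
move=> y Oy; have a0 := out_gt0 nx Oy; have ar := rO _ _ cx Oy.
set a := euclid_norm (x - y) in a0 ar *.
rewrite -sqr_euclid_norm box_cox_sqr// normrM ger0_norm// -mulrA ler_pM2l//.
have ra : r ^- n <= a ^- n.
  by rewrite lef_pV2 ?posrE ?exprn_gt0// lerXn2r ?nnegrE ?(ltW a0) ?(ltW r0).
have an0 : 0 <= a ^- n by rewrite invr_ge0 exprn_ge0 ?(ltW a0).
have B := @box_cox_lip R n (2 * kexp) a r r kexp_ge0.
have {}B : `|box_cox (2 * kexp) a - box_cox (2 * kexp) r| <=
    r `^ (2 * kexp - 1 + n%:R) * r * (a ^- n + a ^- n).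
  apply: le_trans (B _ _) _; rewrite ?a0 ?r0 ?ar ?lexx//.
  apply: ler_pM; rewrite ?mulr_ge0 ?powR_ge0 ?addr_ge0 ?invr_ge0 ?exprn_ge0 ?(ltW a0) ?(ltW r0)//.
    rewrite ler_wpM2l ?powR_ge0// ler_norml; apply/andP; split; lra.
  by rewrite lerD2l.
apply: (@le_trans _ _ (`|box_cox (2 * kexp) r| + `|box_cox (2 * kexp) a - box_cox (2 * kexp) r|)).
  have := ler_normD (box_cox (2 * kexp) r) (box_cox (2 * kexp) a - box_cox (2 * kexp) r).
  by rewrite (addrC (box_cox (2 * kexp) r)) subrK.
rewrite /K [leRHS]mulrDl; apply: lerD B; rewrite -mulrA ler_peMr//.
rewrite mulrDr; apply: (@le_trans _ _ (r ^+ n * r ^- n)).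
  by rewrite mulfV// expf_neq0// gt_eqF.
rewrite -[leLHS]addr0; apply: lerD; first by rewrite ler_wpM2l// exprn_ge0// ltW.
by rewrite mulr_ge0// exprn_ge0// ltW.
Qed.

(** Outside Omega the kernel has no pole on the domain of integration, so the two
    integrands are compared at positive distances only. *)
Lemma potentialE : exists2 C : R, C != 0 &
  forall x, closure Omega x -> ~ Omega x ->
    potential alpha Omega x = C * kernel_potential x.
Proof.
rewrite /potential; have [Na|Na] := eqVneq n.+1%:R alpha.
  exists (- 2^-1) => [|x cx nx]; first by rewrite oppr_eq0 invr_eq0.
  rewrite -RintegralZl//; last exact: integrable_kernel.
  apply: eq_Rintegral => y /set_mem Oy; have xy := out_gt0 nx Oy.
  rewrite div1r lnV// -sqr_euclid_norm /box_cox /kexp Na subrr mul0r eqxx lnXn//.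
  by rewrite -[ln _ *+ 2]mulr_natl mulNr mulKf.
have k0 : kexp != 0 by rewrite mulf_neq0 ?invr_eq0// subr_eq0 eq_sym.
exists kexp => // x cx nx.
rewrite -RintegralZl//; last exact: integrable_kernel.
apply: eq_Rintegral => y /set_mem Oy; have xy := out_gt0 nx Oy.
rewrite div1r -powRN opprB /box_cox (negbTE k0) mulrC divfK// -sqr_euclid_norm.
by rewrite -powR_mulrn ?(ltW xy)// -powRrM /kexp mulrC divfK.
Qed.

End potential_difference.

(** * The difference of the potential at two mirror points *)

Section reflected_difference.
Variables (R : realType) (n : nat) (alpha : R) (Omega : set 'rV[R]_n.+1).
Hypotheses (alpha2 : 2 <= alpha) (oO : open Omega) (bO : bounded_set Omega).
Variable e : 'rV[R]_n.+1.
Hypothesis e1 : dotp e e = 1.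
Implicit Types (x y p : 'rV[R]_n.+1) (m : R).

Let mu := lebesgue_rV R n.+1.
Let mO : measurable Omega := measurable_rV_open oO.
Let k : R := kexp n alpha.

(** The difference of the kernels with poles at p and at its mirror image, divided
    by the signed distance of these two points ([kernel_diffE]). Writing it with
    the divided difference keeps it meaningful when p lies on the hyperplane,
    where it is the derivative of the kernel in the normal direction. *)
Definition kernel_diff m p y : R :=
  2 * (m - dotp y e) * divided_diff k (sqn (p - y)) (sqn (refl e m p - y)).

Lemma kernel_diffE m p y : 2 * (dotp p e - m) * kernel_diff m p y =
  box_cox k (sqn (p - y)) - box_cox k (sqn (refl e m p - y)).
Proof. rewrite divided_diffE (sqnB_refl e1) /kernel_diff; ring. Qed.

Lemma kernel_diff_refl m p y : kernel_diff m p (refl e m y) = - kernel_diff m p y.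
Proof.
rewrite /kernel_diff (dotp_refl e1) (sqn_reflB e1) -(sqn_reflBl e1) divided_diffC; ring.
Qed.

Lemma kernel_diff_gt0 m p y : dotp y e < m -> p != y -> refl e m p != y ->
  0 < kernel_diff m p y.
Proof.
move=> ym py qy; rewrite !mulr_gt0 ?subr_gt0//.
by apply: divided_diff_gt0; rewrite sqn_gt0 subr_eq0.
Qed.

Lemma measurable_kernel_diff m p : dotp p e != m ->
  measurable_fun setT (kernel_diff m p).
Proof.
move=> pm.
have -> : kernel_diff m p = fun y => (box_cox k (sqn (p - y)) - box_cox k (sqn (refl e m p - y))) /
    (2 * (dotp p e - m)).
  apply/funext => y; rewrite -kernel_diffE mulrC mulKf//.
  by rewrite mulf_neq0// subr_eq0.
by apply: measurable_funM => //; apply: measurable_funB;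
  apply: (measurableT_comp (@measurable_box_cox R k)); exact: measurable_sqnB.
Qed.

Lemma dotp_le_euclid_norm x : `|dotp x e| <= euclid_norm x.
Proof.
rewrite -(@ler_pXn2r _ 2)// ?nnegrE ?euclid_norm_ge0//.
rewrite sqr_euclid_norm real_normK ?num_real//.
have := sqn_ge0 (x - dotp x e *: e).
rewrite /sqn !dotpE e1 !(dotpC e); lra.
Qed.

(** The distances to the two poles differ by at most the distance of the poles,
    which cancels the denominator; alpha >= 2 makes the remaining power of the
    distance no worse than -n, which is integrable in dimension n + 1. *)
Lemma kernel_diff_bound : exists2 C, 0 <= C & forall m p,
  closure Omega p -> ~ Omega p -> closure Omega (refl e m p) -> ~ Omega (refl e m p) ->
  dotp p e != m -> forall y, Omega y ->
  `|kernel_diff m p y| <=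
    C * (euclid_norm (p - y) ^- n + euclid_norm (refl e m p - y) ^- n).
Proof.
have [r r0 rO] := diameter_bound bO.
have kge0 : 0 <= 2 * k - 1 + n%:R.
  have -> : 2 * k - 1 + n%:R = alpha - 2.
    by rewrite /k /kexp -[n.+1]addn1 natrD; field.
  by rewrite subr_ge0.
exists (2 * r `^ (2 * k - 1 + n%:R)); first by rewrite mulr_ge0// powR_ge0.
move=> m p cp np cq nq pm y Oy.
have a0 : 0 < euclid_norm (p - y).
  by rewrite euclid_norm_gt0 subr_eq0; apply/eqP => py; apply: np; rewrite py.
have b0 : 0 < euclid_norm (refl e m p - y).
  by rewrite euclid_norm_gt0 subr_eq0; apply/eqP => py; apply: nq; rewrite py.
have ar := rO _ _ cp Oy; have br := rO _ _ cq Oy.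
have E := kernel_diffE m p y; move: E; have AB := sqnB_refl e1 m p y; move: AB.
have := dotp_le_euclid_norm (p - y); have := dotp_le_euclid_norm (refl e m p - y).
rewrite -!sqr_euclid_norm !(dotpBl _ y) (dotp_refl e1) !box_cox_sqr//.
move: (euclid_norm (p - y)) (euclid_norm (refl e m p - y)) a0 b0 ar br => a b a0 b0 ar br.
move: (dotp p e) (dotp y e) pm (kernel_diff m p y) => pe ye pm F bq ap AB E.
have t0 : 0 < `|2 * (pe - m)| by rewrite normr_gt0 mulf_neq0// subr_eq0.
(* Both distances are at least the distance of the projections on e, whence
   a + b >= 2 |m - ye|, while a^2 - b^2 = 4 (pe - m) (m - ye). *)
have abt : `|a - b| <= `|2 * (pe - m)|.
  rewrite -(ler_pM2r (addr_gt0 a0 b0)) -[X in _ * X <= _](gtr0_norm (addr_gt0 a0 b0)).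
  rewrite -normrM -subr_sqr AB.
  have -> : 4 * (pe - m) * (m - ye) = 2 * (pe - m) * (2 * (m - ye)) by ring.
  rewrite normrM ler_wpM2l//; move: bq ap; rewrite !ler_norml => /andP[? ?] /andP[? ?].
  by apply/andP; split; lra.
rewrite -(ler_pM2l t0) -normrM E -mulrBr normrM ger0_norm//.
have := @box_cox_lip R n (2 * k) a b r kge0; rewrite a0 b0 ar br => /(_ isT isT) B.
have ab0 : 0 <= a ^- n + b ^- n by rewrite addr_ge0// invr_ge0 exprn_ge0// ltW.
apply: (@le_trans _ _ (2 * (r `^ (2 * k - 1 + n%:R) * `|2 * (pe - m)| * (a ^- n + b ^- n)))).
  rewrite ler_pM2l//; apply: le_trans B _.
  by rewrite ler_wpM2r// ler_wpM2l// powR_ge0.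
by rewrite le_eqVlt; apply/orP; left; apply/eqP; ring.
Qed.

Lemma integral_kernel_diff_eq0 m p :
  closure Omega p -> ~ Omega p -> closure Omega (refl e m p) -> ~ Omega (refl e m p) ->
  dotp p e != m ->
  kernel_potential alpha Omega p = kernel_potential alpha Omega (refl e m p) ->
  mu.-integrable Omega (EFin \o kernel_diff m p) /\
  \int[mu]_(y in Omega) kernel_diff m p y = 0.
Proof.
move=> cp np cq nq pm; have [C C0 B] := kernel_diff_bound.
have iF : mu.-integrable Omega (EFin \o kernel_diff m p).
  apply: (integrable_dominated oO bO C0 _ (B _ _ cp np cq nq pm)).
  exact: (measurable_funTS (measurable_kernel_diff pm)).
have t0 : 2 * (dotp p e - m) != 0 by rewrite mulf_neq0// subr_eq0.
have E : 2 * (dotp p e - m) * \int[mu]_(y in Omega) kernel_diff m p y =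
    kernel_potential alpha Omega p - kernel_potential alpha Omega (refl e m p).
  rewrite -RintegralZl//; under eq_Rintegral do rewrite kernel_diffE.
  by rewrite RintegralB//; exact: integrable_kernel.
move=> upq; split; first exact: iF.
by apply: (mulfI t0); rewrite E upq subrr mulr0.
Qed.

(** The limit pair may collapse to one point of the hyperplane. The poles move
    along the sequence, so no single function dominates it, and Vitali's theorem
    replaces dominated convergence. *)
Lemma integral_kernel_diff_lim (m_ : nat -> R) (p_ : nat -> 'rV[R]_n.+1) m p :
  (forall j, [/\ closure Omega (p_ j), ~ Omega (p_ j),
     closure Omega (refl e (m_ j) (p_ j)), ~ Omega (refl e (m_ j) (p_ j)) &
     dotp (p_ j) e != m_ j]) ->
  (forall j, \int[mu]_(y in Omega) kernel_diff (m_ j) (p_ j) y = 0) ->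
  m_ @ \oo --> m -> p_ @ \oo --> p ->
  ~ Omega p -> ~ Omega (refl e m p) ->
  mu.-integrable Omega (EFin \o kernel_diff m p) /\
  \int[mu]_(y in Omega) kernel_diff m p y = 0.
Proof.
move=> pmO int0 m_m p_p np nq; have [C C0 B] := kernel_diff_bound.
have mF j : measurable_fun Omega (kernel_diff (m_ j) (p_ j)).
  by have [_ _ _ _ pm] := pmO j; exact: (measurable_funTS (measurable_kernel_diff pm)).
have out x y : ~ Omega x -> Omega y -> 0 < sqn (x - y).
  by move=> nx Oy; rewrite sqn_gt0 subr_eq0; apply/eqP => xy; apply: nx; rewrite xy.
have q_q : refl e (m_ j) (p_ j) @[j --> \oo] --> refl e m p.
  exact: cvg_reflection m_m p_p.
have FF y : Omega y -> kernel_diff (m_ j) (p_ j) y @[j --> \oo] --> kernel_diff m p y.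
  move=> Oy; apply: cvgM.
    by apply: cvgM; [exact: cvg_cst|apply: cvgB => //; exact: cvg_cst].
  apply: divided_diff_cvg; [exact: out|exact: out| | | |].
  - by move=> j; have [_ ? _ _ _] := pmO j; exact: out.
  - by move=> j; have [_ _ _ ? _] := pmO j; exact: out.
  - exact: (continuous_cvg _ (@continuous_sqnB _ _ y p) p_p).
  - exact: (continuous_cvg _ (@continuous_sqnB _ _ y _) q_q).
have [] := @vitali_convergence _ _ R mu Omega mO (lebesgue_rV_bounded_lty oO bO)
  (fun j => kernel_diff (m_ j) (p_ j)) (kernel_diff m p) mF FF.
  move=> eps eps0; have [M M0 H] := @excess_dominated_small R n C eps C0 eps0.
  exists M => // j; have [cp np' cq nq' pm] := pmO j.
  exact: (H _ _ _ _ mO (mF j) (B _ _ cp np' cq nq' pm)).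
move=> iF; under eq_fun do rewrite int0.
move=> c0; split; first exact: iF.
apply/esym; apply: (cvg_unique _ _ c0); first exact: Rhausdorff.
exact: cvg_cst.
Qed.

End reflected_difference.

Section reflected_difference_gt0.
Variables (R : realType) (n : nat) (alpha : R) (Omega : set 'rV[R]_n.+1).
Hypotheses (oO : open Omega).
Variable e : 'rV[R]_n.+1.
Hypothesis e1 : dotp e e = 1.
Implicit Types (x y p : 'rV[R]_n.+1) (m : R).

Let mu := lebesgue_rV R n.+1.
Let mO : measurable Omega := measurable_rV_open oO.

Lemma Rintegral_refl m (f : 'rV[R]_n.+1 -> R) :
  mu.-integrable setT (EFin \o f) ->
  mu.-integrable setT (EFin \o (f \o refl e m)) /\
  \int[mu]_y f (refl e m y) = \int[mu]_y f y.
Proof.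
move=> iF; have mf : measurable_fun setT f.
  by apply/measurable_EFinP; exact: (measurable_int mu).
have mr := @measurable_refl R n.+1 e m.
have mfr : measurable_fun setT (f \o refl e m) by exact: measurableT_comp.
have pushE (h : 'rV[R]_n.+1 -> \bar R) :
    (\int[pushforward mu (refl e m)]_y h y = \int[mu]_y h y)%E.
  by apply: eq_measure_integral => A mA _; exact: lebesgue_rV_refl.
have iFr : mu.-integrable setT (EFin \o (f \o refl e m)).
  apply/integrableP; split; first exact/measurable_EFinP.
  have /integrableP[_] := iF; rewrite -pushE ge0_integral_pushforward//.
  by apply/measurableT_comp => //; exact/measurable_EFinP.
split; first exact: iFr.
rewrite /Rintegral -[in RHS]pushE integral_pushforward//.
exact/measurable_EFinP.
Qed.

(** Folding the integral along the hyperplane leaves a nonnegative integrand: the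
    kernel difference is odd and is positive below the hyperplane, where Omega
    contains the mirror image of its upper cap. Near y0 the mirror image is
    outside Omega, nothing cancels, and the integrand is positive on an open set. *)
Lemma integral_kernel_diff_neq0 m p y0 :
  ~ Omega p -> ~ Omega (refl e m p) ->
  mu.-integrable Omega (EFin \o kernel_diff alpha e m p) ->
  (forall x, Omega x -> m < dotp x e -> Omega (refl e m x)) ->
  Omega y0 -> dotp y0 e < m -> ~ closure Omega (refl e m y0) ->
  \int[mu]_(y in Omega) kernel_diff alpha e m p y <> 0.
Proof.
move=> np nq iF S Oy0 y0m ny0; set F := kernel_diff _ _ _ _ in iF *.
pose f := F \_ Omega.
have fF y : Omega y -> f y = F y by move=> Oy; rewrite /f patchE mem_set.
have f0 y : ~ Omega y -> f y = 0 by move=> Oy; rewrite /f patchE memNset.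
have Fr y : F (refl e m y) = - F y by exact: kernel_diff_refl.
have Fgt0 y : Omega y -> dotp y e < m -> 0 < F y.
  move=> Oy ym; apply: kernel_diff_gt0 => //.
    by apply/eqP => py; apply: np; rewrite py.
  by apply/eqP => py; apply: nq; rewrite py.
have if_ : mu.-integrable setT (EFin \o f).
  by rewrite /f -restrict_EFin; apply/(integrable_mkcond _ mO).
pose g y := f y + f (refl e m y).
have gl y : dotp y e < m -> 0 <= g y.
  move=> ym; rewrite /g; have [Ory|nOry] := pselect (Omega (refl e m y)).
    have Oy : Omega y.
      rewrite -(reflK e1 m y); apply: S => //; rewrite (dotp_refl e1); lra.
    by rewrite !fF// Fr subrr.
  rewrite (f0 _ nOry) addr0; have [Oy|nOy] := pselect (Omega y).
    by rewrite fF// ltW// Fgt0.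
  by rewrite f0.
have g0 y : 0 <= g y.
  have [ym|ym|ym] := ltgtP (dotp y e) m.
  - exact: gl.
  - have <- : g (refl e m y) = g y by rewrite /g (reflK e1) addrC.
    by apply: gl; rewrite (dotp_refl e1); lra.
  - rewrite /g (refl_id ym); have [Oy|nOy] := pselect (Omega y).
      by rewrite fF// /F /kernel_diff ym subrr mulr0 mul0r addr0.
    by rewrite f0// addr0.
have mg : measurable_fun setT (EFin \o g).
  have /measurable_EFinP mf := measurable_int mu if_.
  apply/measurable_EFinP; apply: measurable_funD => //.
  by apply: measurableT_comp => //; exact: measurable_refl.
pose V := [set y | Omega y /\ dotp y e < m /\ ~ closure Omega (refl e m y)].
have oV : open V.
  apply: openI => //; apply: openI; first exact: open_dotp_lt.
  apply: (@open_comp _ _ (refl e m) (~` closure Omega)) => [x _|].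
    exact: continuous_refl.
  by apply: closed_openC; exact: closed_closure.
have Vg y : V y -> g y != 0.
  move=> [Oy [ym nry]]; rewrite gt_eqF// /g fF// f0 ?addr0 ?Fgt0//.
  by move=> Ory; apply: nry; exact: subset_closure.
have Vy0 : V y0 by [].
have gE : \int[mu]_y g y = 2 * \int[mu]_(y in Omega) F y.
  have [ifr intfr] := Rintegral_refl m if_.
  by rewrite (RintegralD _ if_ ifr)// intfr -Rintegral_mkcond -mulr2n mulr_natl.
have ig : mu.-integrable setT (EFin \o g).
  by have [ifr _] := Rintegral_refl m if_; exact: (integrableD measurableT if_ ifr).
have absE : (\int[mu]_y `|(g y)%:E| = (\int[mu]_y g y)%:E)%E.
  rewrite [RHS]fineK; last exact: (integrable_fin_num measurableT ig).
  by apply: eq_integral => y _; rewrite gee0_abs ?lee_fin.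
move=> F0; move: absE; rewrite gE F0 mulr0.
move/(ae_eq_integral_abs mu measurableT mg) => -[N [mN N0 gN]].
apply: (lebesgue_rV_null_interior oV mN N0 _ Vy0) => y Vy.
by apply: gN => /= /(_ I) /= [] /eqP; apply/negP; exact: Vg.
Qed.

End reflected_difference_gt0.

(** * The moving plane *)

Section sequences_and_lines.
Variable R : realType.

Lemma compact_subsequence (T : pseudoMetricType R) (A : set T) (u : nat -> T) :
  compact A -> (forall k, A (u k)) ->
  exists phi p, [/\ A p, (forall j, (j <= phi j)%N) & u (phi j) @[j --> \oo] --> p].
Proof.
move=> cA uA; have [p [Ap clp]] : A `&` cluster (u @ \oo) !=set0.
  apply: (cA (u @ \oo) (fmap_proper_filter _ _)); exists 0%N => // k _; exact: uA.
have /choice[phi phiP] : forall j, exists k, (j <= k)%N /\ ball p (j.+1%:R^-1) (u k).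
  move=> j; have [||y [[k jk <-] pk]] :=
    clp [set u k | k in [set k | (j <= k)%N]] (ball p j.+1%:R^-1).
  - by exists j => // k jk; exists k.
  - by apply: nbhsx_ballx; rewrite invr_gt0.
  - by exists k.
exists phi, p; split => //; first by move=> j; exact: (phiP j).1.
apply/cvg_ballP => eps eps0.
have /cvgr_lt/(_ _ eps0) := @cvg_harmonic R.
by apply: filterS => j /ltW jeps; apply: le_ball jeps _ (phiP j).2.
Qed.

(** The infimum of the parameters at which the ray is outside Omega. *)
Lemma exit_point n (Omega : set 'rV[R]_n) x v s0 : open Omega -> Omega x ->
  0 <= s0 -> ~ Omega (x + s0 *: v) ->
  exists s, [/\ 0 < s, s <= s0, closure Omega (x + s *: v) & ~ Omega (x + s *: v)].
Proof.
move=> oO Ox s00 ns0; pose A := [set s : R | 0 <= s /\ ~ Omega (x + s *: v)].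
have lbA : has_lbound A by exists 0 => s [].
have As0 : A s0 by [].
have iA : has_inf A by split; [exists s0|].
have s10 : 0 <= inf A by apply: lb_le_inf; [exists s0|move=> s []].
have ns1 : ~ Omega (x + inf A *: v).
  move=> O1; have /nbhs_ballP[d/= d0 dO] : nbhs (inf A) ((fun s : R => x + s *: v) @^-1` Omega).
    by apply: continuous_line; exact: open_nbhs_nbhs.
  have [s As sd] := inf_adherent d0 iA.
  have [_] := As; apply; apply: (dO s); rewrite /ball/= ltr_norml.
  have := ge_inf lbA As; move: sd; move: (inf A) => i; lra.
have s1 : 0 < inf A.
  rewrite lt_def s10 andbT; apply/eqP => i0; apply: ns1.
  by rewrite i0 scale0r addr0.
exists (inf A); split => //; first exact: ge_inf.
move=> B /(@continuous_line _ _ x v (inf A))/nbhs_ballP[d/= d0 dB].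
pose s := Num.max (inf A / 2) (inf A - d / 2).
have [sA sd s0'] : [/\ s < inf A, inf A - d < s & 0 <= s].
  by rewrite /s; have [?|?] := leP (inf A / 2) (inf A - d / 2); split; lra.
exists (x + s *: v); split.
  apply/not_notP => nOs; move: sA; rewrite ltNge => /negP; apply.
  by apply: ge_inf => //; split.
by apply: (dB s); rewrite /ball/= ltr_norml; move: (inf A) sA sd => i ? ?; lra.
Qed.

End sequences_and_lines.

Section moving_plane.
Variables (R : realType) (n : nat) (alpha : R) (Omega : set 'rV[R]_n.+1).
Hypotheses (alpha2 : 2 <= alpha) (oO : open Omega) (bO : bounded_set Omega).
Hypothesis O0 : Omega !=set0.
Hypothesis regO : ~` Omega `<=` closure (~` closure Omega).
Hypothesis potO : forall p q, closure Omega p -> ~ Omega p -> closure Omega q -> ~ Omega q ->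
  kernel_potential alpha Omega p = kernel_potential alpha Omega q.
Variable e : 'rV[R]_n.+1.
Hypothesis e1 : dotp e e = 1.
Implicit Types (x y p : 'rV[R]_n.+1) (m : R).

Definition cap_reflects m := forall x, Omega x -> m < dotp x e -> Omega (refl e m x).

Lemma bounded_dotp : exists2 H, 0 <= H & forall x, Omega x -> - H <= dotp x e <= H.
Proof.
have [x0 Ox0] := O0; have [r r0 rO] := diameter_bound bO.
exists (`|dotp x0 e| + r); first by rewrite addr_ge0// ltW.
move=> x Ox; have := rO _ _ (subset_closure Ox) Ox0.
have := dotp_le_euclid_norm e1 (x - x0); rewrite dotpBl -ler_norml => h1 h2.
have := ler_normD (dotp x0 e) (dotp x e - dotp x0 e).
rewrite addrC subrK => /le_trans; apply; rewrite lerD2l; exact: le_trans h2.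
Qed.

(** As the complement of Omega is the closure of its exterior, a mirror image that
    is outside Omega can be moved into the exterior by a small displacement. *)
Let reflected_exterior m x (U : set 'rV[R]_n.+1) : open U -> U x -> Omega x ->
  ~ Omega (refl e m x) ->
  exists y, [/\ U y, Omega y & ~ closure Omega (refl e m y)].
Proof.
move=> oU Ux Ox /regO clx.
have oW : open (refl e m @^-1` (U `&` Omega)).
  by apply: open_comp; [move=> z _; exact: continuous_refl|exact: openI].
have [|z [ncz [Uz Oz]]] := clx (refl e m @^-1` (U `&` Omega)).
  by apply: open_nbhs_nbhs; split => //=; rewrite (reflK e1).
by exists (refl e m z); split => //; rewrite (reflK e1).
Qed.

(** Otherwise some y in the cap has its mirror image at level l in the exterior,
    which is open, so that the image at a slightly higher level is there too. *)
Lemma cap_reflects_closed l : (forall m, l < m -> cap_reflects m) -> cap_reflects l.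
Proof.
move=> Sl x Ox lx; apply/not_notP => nOx.
have [y [ly Oy ncy]] := reflected_exterior (@open_dotp_gt _ _ e l) lx Ox nOx.
have oC : open (~` closure Omega) by apply: closed_openC; exact: closed_closure.
have /nbhs_ballP[d/= d0 dC] : nbhs l ((fun m : R => refl e m y) @^-1` (~` closure Omega)).
  by apply: continuous_refl_level; exact: open_nbhs_nbhs.
move: ly => /= ly.
pose m := Num.min (l + d / 2) ((l + dotp y e) / 2).
have [lm md my] : [/\ l < m, m < l + d & m < dotp y e].
  by rewrite /m; have [?|?] := leP (l + d / 2) ((l + dotp y e) / 2); split; lra.
apply: (dC m); first by rewrite /ball/= ltr_norml; apply/andP; split; lra.
by apply: subset_closure; exact: Sl.
Qed.

(** If x is in the cap and its mirror image is not in Omega, leave Omega from x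
    along e and along -e: the second exit occurs at the mirror image at the
    latest, so the midpoint of the two exits is above the level nu. *)
Lemma critical_pair nu : ~ cap_reflects nu ->
  exists m p, [/\ nu < m, m < dotp p e &
    [/\ closure Omega p, ~ Omega p, closure Omega (refl e m p) & ~ Omega (refl e m p)]].
Proof.
move=> nS; have [x [Ox nux nOx]] : exists x, [/\ Omega x, nu < dotp x e & ~ Omega (refl e nu x)].
  apply/not_notP => H; apply: nS => x Ox nux; apply/not_notP => nOx.
  by apply: H; exists x.
have [H H0 bH] := bounded_dotp.
have [||s [s0 _ cp np]] := @exit_point R _ Omega x e (2 * H + 1) oO Ox.
- lra.
- move=> /bH; rewrite !dotpE e1 mulr1; have := bH _ Ox; lra.
have [||t [t0 tx cq nq]] := @exit_point R _ Omega x (- e) (2 * (dotp x e - nu)) oO Ox.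
- lra.
- by rewrite scalerN.
pose m := dotp x e + (s - t) / 2.
exists m, (x + s *: e).
have qE : refl e m (x + s *: e) = x + t *: - e.
  rewrite /refl !dotpE e1 mulr1 scalerN -addrA -scalerBl -scaleNr.
  congr (_ + _ *: _); rewrite /m; lra.
rewrite qE; split; [rewrite /m; lra| |by []].
by rewrite !dotpE e1 mulr1 /m; lra.
Qed.

(** The level m is the infimum l0 of the levels above which all caps reflect into
    Omega, unless symmetry is already reached above. If it failed at every level
    m >= l0, then by [integral_kernel_diff_neq0] no pair of mirror points of the
    boundary could exist at those levels; but the critical pairs for levels
    increasing to l0 have midpoints there or converge to such a pair at l0. *)
Theorem symmetric_direction : exists m,
  (forall l, m <= l -> cap_reflects l) /\ (forall x, Omega x -> Omega (refl e m x)).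
Proof.
have [H H0 bH] := bounded_dotp; have [x0 Ox0] := O0.
pose G := [set l | forall m, l <= m -> cap_reflects m].
have GH : G H by move=> m Hm x /bH/andP[_ xH]; lra.
have lG : lbound G (- H).
  move=> l Gl; rewrite leNgt; apply/negP => lH.
  have lx0 : l < dotp x0 e by have /andP[? _] := bH _ Ox0; lra.
  have /bH := Gl l (lexx l) x0 Ox0 lx0; rewrite (dotp_refl e1); lra.
have iG : has_inf G by split; [exists H|exists (- H)].
set l0 := inf G.
have S_gt m : l0 < m -> cap_reflects m.
  move=> lm; have ml : 0 < m - l0 by lra.
  have [l Gl ll] := inf_adherent ml iG; apply: Gl; move: ll; rewrite -/l0; lra.
have S_l0 := cap_reflects_closed S_gt.
have S_ge m : l0 <= m -> cap_reflects m.
  by rewrite le_eqVlt => /orP[/eqP<-//|]; exact: S_gt.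
apply/not_notP => nsym.
(* Absence of a witness at level m would make Omega symmetric at that level. *)
have witness m : l0 <= m -> exists y, [/\ dotp y e < m, Omega y & ~ closure Omega (refl e m y)].
  move=> lm; apply/not_notP => nw; apply: nsym; exists m; split.
    by move=> l ml; apply: S_ge; exact: le_trans ml.
  move=> x Ox; have [xm|mx|xm] := ltgtP (dotp x e) m.
  - apply/not_notP => nOx; apply: nw.
    have [y [? ? ?]] := reflected_exterior (@open_dotp_lt _ _ e m) xm Ox nOx.
    by exists y.
  - exact: S_ge.
  - by rewrite refl_id.
have crit m p : l0 <= m -> ~ Omega p -> ~ Omega (refl e m p) ->
    (lebesgue_rV R n.+1).-integrable Omega (EFin \o kernel_diff alpha e m p) ->
    \int[lebesgue_rV R n.+1]_(y in Omega) kernel_diff alpha e m p y <> 0.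
  move=> lm np nq iF; have [y [ym Oy ncy]] := witness m lm.
  exact: (integral_kernel_diff_neq0 oO e1 np nq iF (S_ge _ lm) Oy ym ncy).
have /choice[mp mpP] : forall j : nat, exists mp : R * 'rV[R]_n.+1,
   let m := mp.1 in let p := mp.2 in
   [/\ l0 - j.+1%:R^-1 <= m <= l0, dotp p e != m & 
     [/\ closure Omega p, ~ Omega p, closure Omega (refl e m p) & ~ Omega (refl e m p)]].
  move=> j; have j0 : 0 < j.+1%:R^-1 :> R by rewrite invr_gt0.
  have [nu lnu nS] : exists2 nu, l0 - j.+1%:R^-1 <= nu & ~ cap_reflects nu.
    apply/not_notP => Hn.
    have Gj : G (l0 - j.+1%:R^-1).
      by move=> nu lnu; apply/not_notP => nS; apply: Hn; exists nu.
    by have := ge_inf iG.2 Gj; rewrite -/l0 lerDl oppr_ge0 leNgt j0.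
  have [m [p [num mp [cp np cq nq]]]] := critical_pair nS.
  have pm : dotp p e != m by rewrite gt_eqF.
  exists (m, p); split => //=; apply/andP; split; first by apply: ltW; exact: le_lt_trans num.
  rewrite leNgt; apply/negP => lm.
  have [iF F0] := integral_kernel_diff_eq0 alpha2 oO bO e1 cp np cq nq pm (potO cp np cq nq).
  exact: (crit m p (ltW lm) np nq iF F0).
have cC : compact (closure Omega).
  apply: bounded_closed_compact; last exact: closed_closure.
  have [M [Mr MO]] := bO; exists (`|M| + 1 + 1); split; first exact: num_real.
  move=> B MB y /(_ _ (nbhsx_ballx y _ ltr01)) [y' [Oy' yy']].
  have y'M : `|y'| <= `|M| + 1.
    by apply: (MO (`|M| + 1)) => //; rewrite (le_lt_trans (ler_norm _))// ltrDl.
  move: yy'; rewrite -ball_normE/= => yy'.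
  have := ler_normD (y - y') y'; rewrite subrK; lra.
have cl j : closure Omega (mp j).2 by have [_ _ []] := mpP j.
have [phi [p [cp phij pp]]] := compact_subsequence cC cl.
have mm : (mp (phi j)).1 @[j --> \oo] --> l0.
  apply/cvgrPdist_lt => eps eps0; have /cvgr_lt/(_ _ eps0) := @cvg_harmonic R.
  apply: filterS => j; move=> /= jeps.
  have [/andP[lm ml] _ _] := mpP (phi j).
  have phij' : (phi j).+1%:R^-1 <= j.+1%:R^-1 :> R.
    by rewrite lef_pV2 ?posrE// ler_nat ltnS.
  rewrite ger0_norm ?subr_ge0//; move: lm jeps phij'.
  move: ((phi j).+1%:R^-1 : R) (j.+1%:R^-1 : R) => a b. lra.
have nP : ~ Omega p.
  have cO : closed (~` Omega) by exact: open_closedC.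
  apply: (@closed_cvg _ _ _ _ (fun j => (mp (phi j)).2) _ cO _ p pp); apply: nearW => j.
  by have [_ _ []] := mpP (phi j).
have qq : refl e (mp (phi j)).1 (mp (phi j)).2 @[j --> \oo] --> refl e l0 p.
  exact: cvg_reflection mm pp.
have nQ : ~ Omega (refl e l0 p).
  have cO : closed (~` Omega) by exact: open_closedC.
  apply: (@closed_cvg _ _ _ _ (fun j => refl e (mp (phi j)).1 (mp (phi j)).2) _ cO _ _ qq).
  apply: nearW => j.
  by have [_ _ []] := mpP (phi j).
have [iF F0] : (lebesgue_rV R n.+1).-integrable Omega (EFin \o kernel_diff alpha e l0 p) /\
    \int[lebesgue_rV R n.+1]_(y in Omega) kernel_diff alpha e l0 p y = 0.
  apply: (@integral_kernel_diff_lim _ _ _ _ alpha2 oO bO e e1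
    (fun j => (mp (phi j)).1) (fun j => (mp (phi j)).2)).
  - by move=> j; have [_ ? []] := mpP (phi j).
  - move=> j; have [_ pm [cp' np' cq' nq']] := mpP (phi j).
    have potE := potO cp' np' cq' nq'.
    by have [_] := integral_kernel_diff_eq0 alpha2 oO bO e1 cp' np' cq' nq' pm potE.
  - exact: mm.
  - exact: pp.
  - exact: nP.
  - exact: nQ.
exact: (crit l0 p (lexx l0) nP nQ iF F0).
Qed.

End moving_plane.

(** * From symmetry in all directions to a ball *)

Section symmetric_sets.
Variables (R : realType) (n : nat) (Omega : set 'rV[R]_n.+1).
Hypotheses (oO : open Omega) (bO : bounded_set Omega) (O0 : Omega !=set0).
Hypothesis symO : forall e, dotp e e = 1 -> exists m,
  (forall l, m <= l -> cap_reflects Omega e l) /\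
  (forall x, Omega x -> Omega (refl e m x)).
Implicit Types (x y z c e : 'rV[R]_n.+1).

(** The supremum of the component along e would increase by delta. *)
Lemma no_translation e delta : dotp e e = 1 -> 0 < delta ->
  ~ (forall x, Omega x -> exists2 y, Omega y & dotp y e = dotp x e + delta).
Proof.
move=> e1 d0 tr; have [H H0 bH] := bounded_dotp bO O0 e1.
pose A := [set dotp x e | x in Omega].
have sA : has_sup A.
  by have [x0 Ox0] := O0; split; [exists (dotp x0 e), x0|exists H => _ [x /bH/andP[_ ?] <-]].
have [_ [x Ox <-] xs] := sup_adherent d0 sA.
have [y Oy yx] := tr x Ox.
have : dotp y e <= sup A by apply: ub_le_sup; [exact: sA.2|exists y].
rewrite yx; lra.
Qed.

Lemma dotp_delta x i : dotp x (delta_mx ord0 i) = x ord0 i.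
Proof.
rewrite /dotp (bigD1 i)//= big1 => [|j ji]; last by rewrite mxE (negbTE ji) andbF mulr0.
by rewrite mxE !eqxx mulr1 addr0.
Qed.

Lemma dotp_delta1 (i : 'I_n.+1) : dotp (delta_mx ord0 i) (delta_mx ord0 i) = 1 :> R.
Proof. by rewrite dotp_delta mxE !eqxx. Qed.

(** Reflecting in the N coordinate hyperplanes of symmetry one after the other
    negates all coordinates relative to their common point. *)
Lemma center_of_symmetry : exists c, forall x, Omega x -> Omega (c + c - x).
Proof.
have /choice[m mP] : forall i : 'I_n.+1, exists m,
    forall x, Omega x -> Omega (refl (delta_mx ord0 i) m x).
  by move=> i; have [m [_ ?]] := symO (dotp_delta1 i); exists m.
pose c : 'rV[R]_n.+1 := \row_i m i; exists c => x Ox.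
pose flip k : 'rV[R]_n.+1 :=
  \row_i (if (i < k)%N then m i + m i - x ord0 i else x ord0 i).
suff flipO k : (k <= n.+1)%N -> Omega (flip k).
  have := flipO n.+1 (leqnn _); congr Omega; apply/rowP => i.
  by rewrite !mxE ltn_ord.
elim: k => [_|k IH kn]; first by rewrite (_ : flip 0%N = x)//; apply/rowP => i; rewrite mxE.
have := mP (Ordinal kn) _ (IH (ltnW kn)); congr Omega; apply/rowP => i.
rewrite /refl dotp_delta !mxE/= ltnn [(i < k.+1)%N]ltnS [(i <= k)%N]leq_eqVlt.
have [ik|ik] := eqVneq i (Ordinal kn).
  by rewrite ik /= eqxx ltnn; ring.
rewrite (_ : (i == k :> nat) = false) ?mulr0 ?subr0//.
by apply/negbTE; apply: contraNneq ik => ik; apply/eqP/val_inj.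
Qed.

(** The hyperplane of symmetry with normal e contains c: otherwise composing its
    reflection with the central symmetry would translate the component along e. *)
Lemma symmetric_through_center c e : dotp e e = 1 ->
  (forall x, Omega x -> Omega (c + c - x)) ->
  (forall x, Omega x -> Omega (refl e (dotp c e) x)) /\
  (forall x l, Omega x -> dotp c e <= l -> l <= dotp x e ->
    Omega (x - (2 * (dotp x e - l)) *: e)).
Proof.
move=> e1 cO; have [m [mS mO]] := symO e1.
have -> : dotp c e = m.
  have [cm|mc|//] := ltgtP (dotp c e) m; exfalso.
    apply: (@no_translation e (2 * (m - dotp c e)) e1); first by rewrite mulr_gt0// subr_gt0.
    move=> x Ox; exists (refl e m (c + c - x)); first by apply: mO; exact: cO.
    by rewrite (dotp_refl e1) !dotpE; ring.
  apply: (@no_translation e (2 * (dotp c e - m)) e1); first by rewrite mulr_gt0// subr_gt0.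
  move=> x Ox; exists (c + c - refl e m x); first by apply: cO; exact: mO.
  by rewrite dotpBl dotpDl (dotp_refl e1); ring.
split => // x l Ox ml lx; have [xl|xl|xl] := ltgtP l (dotp x e).
- exact: (mS l).
- by move: lx; rewrite leNgt xl.
- by rewrite xl subrr mulr0 scale0r subr0.
Qed.

(** Reflections through c act transitively on the spheres around c, and the
    segments from x towards its mirror image stay in Omega, so with x the set
    contains all points that are not farther from c than x. *)
Lemma ball_of_symmetric : exists c r, 0 < r /\ Omega = euclid_ball c r.
Proof.
have [c cO] := center_of_symmetry.
have normalize v : v != 0 -> exists e a, [/\ dotp e e = 1, 0 < a & v = a *: e].
  move=> v0; have a0 : 0 < euclid_norm v by rewrite euclid_norm_gt0.
  exists ((euclid_norm v)^-1 *: v), (euclid_norm v); split => //.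
    rewrite !dotpE -[dotp v v]/(sqn v) -sqr_euclid_norm; field; exact: lt0r_neq0.
  by rewrite scalerA mulfV ?scale1r// gt_eqF.
have star x z : Omega x -> euclid_norm (z - c) <= euclid_norm (x - c) -> Omega z.
  move=> Ox; set b := euclid_norm (z - c) => zx.
  have [xc|xc] := eqVneq x c.
    move: zx; rewrite xc subrr euclid_normE sqn0 sqrtr0.
    by rewrite leNgt euclid_norm_gt0 negbK subr_eq0 -xc => /eqP ->.
  have [e [a [e1 a0 xca]]] : exists e a, [/\ dotp e e = 1, 0 < a & x - c = a *: e].
    by apply: normalize; rewrite subr_eq0.
  have aE : euclid_norm (x - c) = a.
    by rewrite xca euclid_normE sqnZ [sqn e]e1 mulr1 sqrtr_sqr gtr0_norm.
  have xce : dotp x e = dotp c e + a.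
    by rewrite -[x in LHS](subrK c) xca !dotpE e1 mulr1 addrC.
  have b0 : 0 <= b := euclid_norm_ge0 _.
  rewrite aE in zx.
  (* The point of the ray from c through x at the distance b of z. *)
  have Oz' : Omega (c + b *: e).
    have [_ seg] := symmetric_through_center e1 cO.
    have := seg x (dotp c e + (a + b) / 2) Ox; rewrite xce => H.
    have -> : c + b *: e = x - (2 * (dotp c e + a - (dotp c e + (a + b) / 2))) *: e.
      by rewrite -[x in RHS](subrK c) xca; apply/rowP => i; rewrite !mxE; field.
    by apply: H; lra.
  have [<-//|zz'] := eqVneq (c + b *: e) z.
  have [f [d [f1 d0 zd]]] : exists f d, [/\ dotp f f = 1, 0 < d & (c + b *: e) - z = d *: f].
    by apply: normalize; rewrite subr_eq0.
  have [rf _] := symmetric_through_center f1 cO.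
  have := rf _ Oz'; congr Omega.
  have sb : sqn (z - c) = b ^+ 2 by rewrite sqr_euclid_norm.
  have zE : z = (c + b *: e) - d *: f by rewrite -zd opprB addrC subrK.
  have : 2 * (b * dotp e f) = d.
    apply: (mulfI (lt0r_neq0 d0)); move: sb; rewrite zE /sqn !dotpE e1 f1.
    rewrite !(dotpC f) !(dotpC e c); lra.
  rewrite zE /refl !dotpE => <-; apply/rowP => i; rewrite !mxE; ring.
have outer x : Omega x -> exists2 y, Omega y & euclid_norm (x - c) < euclid_norm (y - c).
  move=> Ox; pose v := if x == c then delta_mx ord0 ord0 else x - c.
  have v0 : 0 < sqn v.
    rewrite /v; have [_|xc] := eqVneq x c; last by rewrite sqn_gt0 subr_eq0.
    by rewrite [sqn _](dotp_delta1 ord0).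
  have xv : 0 <= dotp (x - c) v.
    rewrite /v; have [->|xc] := eqVneq x c; first by rewrite subrr dotp0l.
    exact: sqn_ge0.
  have /nbhs_ballP[d/= d0 dO] : nbhs 0 ((fun s : R => x + s *: v) @^-1` Omega).
    by apply: continuous_line; rewrite scale0r addr0; exact: open_nbhs_nbhs.
  have d2 : 0 < d / 2 by rewrite divr_gt0.
  exists (x + (d / 2) *: v).
    by apply: (dO (d / 2)); rewrite /ball/= sub0r normrN gtr0_norm//; lra.
  rewrite -(@ltr_pXn2r _ 2)// ?nnegrE ?euclid_norm_ge0// !sqr_euclid_norm.
  rewrite [x + _ - c]addrAC; move: xv; move: (x - c) => w wv.
  rewrite /sqn !dotpE (dotpC v).
  have : 0 < d / 2 * (d / 2 * dotp v v) by rewrite !mulr_gt0.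
  have : 0 <= d / 2 * dotp w v by rewrite mulr_ge0// ltW.
  by lra.
have Oc : Omega c.
  have [x Ox] := O0; apply: (star x) => //.
  by rewrite subrr euclid_normE sqn0 sqrtr0 euclid_norm_ge0.
(* Omega is open, so the supremum of the distances to c is not attained. *)
pose A := [set euclid_norm (x - c) | x in Omega].
have sA : has_sup A.
  split; first by exists (euclid_norm (c - c)), c.
  have [r r0 rO] := diameter_bound bO; exists r => _ [x Ox <-].
  by apply: rO => //; exact: subset_closure.
have ltA x : Omega x -> euclid_norm (x - c) < sup A.
  move=> /outer[y Oy]/lt_le_trans; apply; apply: ub_le_sup; first exact: sA.2.
  by exists y.
exists c, (sup A); split.
  by apply: le_lt_trans (ltA c Oc); exact: euclid_norm_ge0.
apply/seteqP; split => [x /ltA//|z /= zA].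
have zA0 : 0 < sup A - euclid_norm (z - c) by rewrite subr_gt0.
have [_ [x Ox <-]] := sup_adherent zA0 sA; rewrite subKr => zx.
by apply: (star x z Ox); exact: ltW.
Qed.

End symmetric_sets.

(** * Regularity of the boundary *)

Lemma open_euclid_ball (R : realType) n (c : 'rV[R]_n) r : 0 < r -> open (euclid_ball c r).
Proof.
move=> r0; have := @open_sqnB_lt R n c (r ^+ 2); congr open.
apply/seteqP; split => x; rewrite /euclid_ball/= -sqr_euclid_norm;
  by rewrite ltr_pXn2r// nnegrE ?euclid_norm_ge0// ltW.
Qed.

(** Descending from a boundary point along the last axis of its chart leads
    strictly below the graph; continuity of g makes that region open, so its
    points are in the exterior of Omega. *)
Lemma C1_boundary_regular (R : realType) n (Omega : set 'rV[R]_n.+1) :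
  open Omega -> C1_boundary Omega -> ~` Omega `<=` closure (~` closure Omega).
Proof.
move=> oO C1O z nOz; have [cz|ncz] := pselect (closure Omega z); last exact: subset_closure.
have [|Q [g [r [QQ [dg _] r0 H]]]] := C1O z.
  by split => // /interior_subset.
have QQ' : Q^T *m Q = 1%:M by exact: mulmx1C.
have cQ j : continuous (fun x : 'rV[R]_n.+1 => (x *m Q) ord0 j).
  under eq_fun do rewrite mxE.
  by apply: continuous_sum => k x; exact: (cvgM (@continuous_coord _ _ k x) (cvg_cst _)).
have cg : continuous (fun x : 'rV[R]_n.+1 => g (col' ord_max (x *m Q)) - (x *m Q) ord0 ord_max).
  have ccol : continuous (fun x : 'rV[R]_n.+1 => col' ord_max (x *m Q) : 'rV[R]_n).
    by apply: continuous_rowP => j; under eq_fun do rewrite mxE; exact: cQ.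
  move=> x; have gx : {for col' ord_max (x *m Q), continuous g}.
    exact: differentiable_continuous.
  exact: (cvgB (continuous_cvg _ gx (ccol x)) (cQ ord_max x)).
pose W := euclid_ball z r `&`
  [set x | 0 < g (col' ord_max (x *m Q)) - (x *m Q) ord0 ord_max].
have oW : open W.
  apply: openI; first exact: open_euclid_ball.
  apply: (@open_comp _ _ (fun x : 'rV[R]_n.+1 =>
    g (col' ord_max (x *m Q)) - (x *m Q) ord0 ord_max) [set s | 0 < s]) => [x _|].
    exact: cg.
  exact: open_gt.
have zr : euclid_ball z r z by rewrite /euclid_ball/= subrr euclid_normE sqn0 sqrtr0.
move=> B Bz; pose v : 'rV[R]_n.+1 := - delta_mx ord0 ord_max *m Q^T.
have /nbhs_ballP[d/= d0 dB] : nbhs 0 ((fun s : R => z + s *: v) @^-1` (B `&` euclid_ball z r)).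
  apply: continuous_line; rewrite scale0r addr0; apply: filterI => //.
  by apply: open_nbhs_nbhs; split => //; exact: open_euclid_ball.
have d2 : 0 < d / 2 by rewrite divr_gt0.
have [Bz' rz'] : (B `&` euclid_ball z r) (z + (d / 2) *: v).
  by apply: (dB (d / 2)); rewrite /ball/= sub0r normrN gtr0_norm//; lra.
exists (z + (d / 2) *: v); split => // cz'.
have Wz' : W (z + (d / 2) *: v).
  split => //=; rewrite mulmxDl -scalemxAl /v -mulmxA QQ' mulmx1 scalerN.
  have -> : col' ord_max (z *m Q - (d / 2) *: delta_mx ord0 ord_max) = col' ord_max (z *m Q).
    apply/rowP => j; rewrite !mxE (_ : lift _ _ == _ = false) ?andbF ?mulr0 ?subr0//.
    by rewrite eq_sym; apply/negbTE/neq_lift.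
  have : ~ g (col' ord_max (z *m Q)) < (z *m Q) ord0 ord_max by move=> /(H z zr).2.
  have -> : (z *m Q - (d / 2) *: delta_mx ord0 ord_max) ord0 ord_max =
      (z *m Q) ord0 ord_max - d / 2.
    by move: (z *m Q) => w; rewrite !mxE !eqxx mulr1.
  by move/negP; rewrite -leNgt; lra.
have [x [Ox [xr gx]]] := cz' W (open_nbhs_nbhs (conj oW Wz')).
by have := (H x xr).1 Ox; move: gx => /=; lra.
Qed.

Theorem theorem1 (R : realType) (n : nat) (alpha : R)
    (Omega : set 'rV[R]_n.+1) :
  2 <= alpha ->
  domain Omega -> bounded_set Omega -> C1_boundary Omega ->
  (exists c : R, forall x, boundary Omega x -> potential alpha Omega x = c) ->
  exists (c : 'rV[R]_n.+1) (r : R), 0 < r /\ Omega = euclid_ball c r.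
Proof.
move=> alpha2 [ne _ oO] bO bdC1 [c uc].
have regO := C1_boundary_regular oO bdC1.
have [K K0 uE] := potentialE alpha2 oO bO.
have bdO p : closure Omega p -> ~ Omega p -> boundary Omega p.
  by move=> cp np; split => // /interior_subset.
have KuE p : closure Omega p -> ~ Omega p -> K * kernel_potential alpha Omega p = c.
  by move=> cp np; rewrite -(uE p cp np); exact: (uc p (bdO p cp np)).
apply: (ball_of_symmetric oO bO ne) => e e1.
apply: (symmetric_direction alpha2 oO bO ne regO _ e1) => p q cp np cq nq.
exact: (mulfI K0 (etrans (KuE p cp np) (esym (KuE q cq nq)))).
Qed.
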